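(* Let $\omega\in\mathcal{I}$ be such that both $\omega(r)$ and $\frac{\psi_\omega(r)}{1-r}$ are essentially increasing on $[0,1)$, and such that there is a constant $C>0$ with $$\int_r^1\omega(s)s\,ds\le C\int_{\frac{2r}{1+r^2}}^1\omega(s)s\,ds,\quad 0\le r<1 .$$ Then $\mathcal{C}^1(\omega^\star)$ is not conformally invariant.
   Context: $\mathbb{D}$ is the open unit disc, $\mathbb{T}$ its boundary, $\mathcal{H}(\mathbb{D})$ the set of analytic functions in $\mathbb{D}$, $dA=\frac{dx\,dy}{\pi}$. A weight is a function $\omega:\mathbb{D}\to(0,\infty)$ integrable over $\mathbb{D}$; it is radial if $\omega(z)=\omega(|z|)$. For a radial weight put $\psi_\omega(r)=\frac{1}{\omega(r)}\int_r^1\omega(s)\,ds$. $\mathcal{I}$: continuous radial weights with $\lim_{r\to1^-}\frac{\psi_\omega(r)}{1-r}=\infty$. A function $h:[0,1)\to(0,\infty)$ is essentially increasing on $[0,1)$ if there is $C>0$ with $h(r)\le Ch(t)$ for all $0\le r\le t<1$. $\omega^\star(z)=\int_{|z|}^1\omega(s)\log\frac{s}{|z|}\,s\,ds$, $z\in\mathbb{D}\setminus\{0\}$. For an interval $I\subset\mathbb{T}$ of Lebesgue measure $|I|$, $S(I)=\{re^{it}\in\mathbb{D}:e^{it}\in I,\ 1-|I|\le r<1\}$, and $\omega(E)=\int_E\omega\,dA$. $\mathcal{C}^1(\omega^\star)$ consists of $g\in\mathcal{H}(\mathbb{D})$ for which the seminorm $\rho(g)=\left(\sup_{I\subset\mathbb{T}}\frac{\int_{S(I)}|g'|^2\omega^\star\,dA}{\omega(S(I))}\right)^{1/2}$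 is finite. A space $X\subset\mathcal{H}(\mathbb{D})$ equipped with a seminorm $\rho$ is conformally invariant if there is a constant $C>0$ such that $\sup_\varphi\rho(g\circ\varphi)\le C\rho(g)$ for all $g\in X$, where the supremum is over all M\''obius transformations $\varphi$ of $\mathbb{D}$ onto itself. *)

(* Defs.v *)
From HB Require Import structures.
From mathcomp Require Import all_boot all_order all_algebra.
From mathcomp Require Import complex.
From mathcomp Require Import all_classical all_reals all_analysis.

Set Implicit Arguments.
Unset Strict Implicit.
Unset Printing Implicit Defensive.

Import Order.TTheory GRing.Theory Num.Theory.
Import numFieldNormedType.Exports.

Local Open Scope classical_set_scope.
Local Open Scope complex_scope.
Local Open Scope ring_scope.

(* Functions on the unit disc are represented by total functions on R[i];
   no definition below depends on their values outside the disc. *)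

Definition cmod (R : realType) (z : R[i]) : R := ComplexField.Normc.normc z.

Definition disc (R : realType) : set R[i] := [set z | cmod z < 1].

Definition planar (R : realType) (p : R * R) : R[i] := p.1 +i* p.2.

Definition dA_integral (R : realType) (E : set R[i]) (f : R[i] -> R) : \bar R :=
  ((pi^-1)%:E *
   \int[@lebesgue_measure R \x @lebesgue_measure R]_(p in @planar R @^-1` E)
     (f (planar p))%:E)%E.

(* R[i]^o is R[i] as a normed module over itself: derivability over the field
   R[i] is complex differentiability. *)
Definition cderivable (R : realType) (g : R[i] -> R[i]) (z : R[i]) : Prop :=
  derivable (g : R[i]^o -> R[i]^o) z 1.

Definition cderive (R : realType) (g : R[i] -> R[i]) (z : R[i]) : R[i] :=
  derive1 (g : R[i]^o -> R[i]^o) z.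

Definition analytic_disc (R : realType) : set (R[i] -> R[i]) :=
  [set g | forall z, disc z -> cderivable g z].

Definition weight (R : realType) (w : R[i] -> R) : Prop :=
  (forall z, disc z -> 0 < w z) /\
  (@lebesgue_measure R \x @lebesgue_measure R)%E.-integrable
    (@planar R @^-1` @disc R) (fun p => (w (planar p))%:E).

Definition radial (R : realType) (w : R[i] -> R) : Prop :=
  forall z, disc z -> w z = w (cmod z)%:C.

Definition psi (R : realType) (w : R[i] -> R) (r : R) : R :=
  (w r%:C)^-1 * \int[@lebesgue_measure R]_(s in `[r, 1[) w s%:C.

Definition class_I (R : realType) (w : R[i] -> R) : Prop :=
  [/\ weight w,
      radial w,
      forall z, disc z -> {for z, continuous (w : R[i]^o -> R)}
    & psi w r / (1 - r) @[r --> 1^'-] --> +oo].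

Definition essentially_increasing (R : realType) (h : R -> R) : Prop :=
  exists2 C : R, 0 < C & forall r t : R, 0 <= r -> r <= t -> t < 1 ->
    h r <= C * h t.

(* The value at z = 0, where the formula is not meaningful, only concerns a
   null set. *)
Definition wstar (R : realType) (w : R[i] -> R) (z : R[i]) : R :=
  \int[@lebesgue_measure R]_(s in `[cmod z, 1[) (w s%:C * ln (s / cmod z) * s).

(* An interval of the unit circle is the image under t |-> exp (it) of a real
   interval J with endpoints a and b, where 0 < b - a <= 2 pi; its Lebesgue
   measure is then b - a. The booleans p and q say which endpoints belong to
   J. *)
Definition carleson_square (R : realType) (p q : bool) (a b : R) : set R[i] :=
  [set z | exists r t : R,
    [/\ 0 <= r, 1 - (b - a) <= r, r < 1,
        t \in Interval (BSide p a) (BSide q b)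
      & z = r%:C * (cos t +i* sin t)]].

Definition C1_ratio (R : realType) (w v : R[i] -> R) (g : R[i] -> R[i])
    (E : set R[i]) : \bar R :=
  (dA_integral E (fun z => cmod (cderive g z) ^+ 2 * v z)%R /
   dA_integral E w)%E.

Definition C1_seminorm (R : realType) (w : R[i] -> R) (g : R[i] -> R[i])
    : \bar R :=
  sqrte (ereal_sup
    [set x | exists (p q : bool) (a b : R),
       [/\ a < b, b - a <= 2 * pi
         & x = C1_ratio w (wstar w) g (carleson_square p q a b)]]).

(* The space C^1(w^star). *)
Definition C1_space (R : realType) (w : R[i] -> R) : set (R[i] -> R[i]) :=
  [set g | analytic_disc g /\ (C1_seminorm w g < +oo)%E].

(* The second condition excludes poles in the disc. *)
Definition disc_mobius (R : realType) : set (R[i] -> R[i]) :=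
  [set phi | (exists a b c d : R[i],
      [/\ a * d - b * c != 0,
          forall z, disc z -> c * z + d != 0
        & forall z, disc z -> phi z = (a * z + b) / (c * z + d)]) /\
    phi @` @disc R = @disc R].

(* The seminorm rho is extended-valued: it is +oo on functions for which it is
   not finite. *)
Definition conformally_invariant (R : realType) (X : set (R[i] -> R[i]))
    (rho : (R[i] -> R[i]) -> \bar R) : Prop :=
  exists2 C : R, 0 < C & forall g, X g ->
    (ereal_sup [set rho (g \o phi) | phi in @disc_mobius R] <= C%:E * rho g)%E.

(* Main.v *)
Require Import Defs.
From HB Require Import structures.
From mathcomp Require Import all_boot all_order all_algebra.
From mathcomp Require Import complex.
From mathcomp Require Import all_classical all_reals all_analysis.
From mathcomp Require Import measurable_realfun ring lra zify.
Import Order.TTheory GRing.Theory Num.Theory.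
Import numFieldNormedType.Exports.
Local Open Scope classical_set_scope.
Local Open Scope complex_scope.
Local Open Scope ring_scope.

Set Implicit Arguments.
Unset Strict Implicit.
Unset Printing Implicit Defensive.

(** Write W(r) for the integral of the weight over [r, 1) and
    e(r) = (1 - r) w(r) / W(r) = (1 - r) / psi(r). The two monotonicity
    hypotheses say that e is almost decreasing and that e(r) / (1 - r) is
    almost increasing ([decay_almost_decreasing], [decay_almost_linear]).

    Take the lacunary polynomials g_N = sum_(k < N) c_k z^(m_k) with
    m_k = p^(2 (k + 1)) and c_k^2 = e(1 - 1 / m_k). As e varies slowly, at
    modulus r the sum for g_N' is governed by the terms with m_k of order
    1 / (1 - r), so (1 - |z|)^2 |g_N'(z)|^2 <= const e(|z|), uniformly in N.
    Since wstar(z) <= (1 - |z|) / |z| W(|z|), this gives the pointwise bound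
    |g_N'|^2 wstar <= const w ([weighted_lacunary_deriv_le]); integrating it
    over Carleson squares bounds the seminorms of all g_N by one constant.

    Conversely, if p is large, a single term dominates on the annulus where
    m_n (1 - |z|) is of order 1, whence (1 - |z|) |g_N'(z)| >= c_n / 256
    there ([lacunary_dominant_term]). Let phi be the involutive Moebius map of
    the disc exchanging 0 and a = 1 - d, and look at the Carleson square of
    side d centred at the point 1. There 1 - |phi(z)| is comparable to
    (1 - |z|) / d, so phi takes the sector where (1 - |z|) / d is of order
    1 / m_n into the n-th annulus ([mobius_annulus]), and the invariance of
    |g'(z)| (1 - |z|^2) under Moebius maps turns the lower bound into
    |(g_N o phi)'(z)| >= const c_n / (1 - |z|). On these sectors 1 - |z| is
    much larger than d^2 when d is small compared with 1 / m_N, and the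
    doubling hypothesis, which compares W(a) with W at a point whose distance
    to 1 is of order d^2, gives wstar(z) >= const (1 - |z|) W(a). So each of
    the N sectors contributes at least const c_n^2 d W(a) to the numerator of
    the ratio, while the weight of the square is at most const d W(a); the
    ratio is at least const sum_(n < N) c_n^2 ([lacunary_mobius_ratio_ge]).

    Finally sum c_n^2 diverges, because W(r_n) - W(r_(n+1)) is at most
    const c_n^2 W(r_n) for r_n = 1 - 1 / m_n while W(r_n) tends to 0
    ([sum_decay_unbounded]). Hence the seminorms of g_N o phi are unbounded
    and those of g_N are not. *)

(** * Elementary inequalities *)

(** A two-sided geometric sum: the terms grow like powers of p while
    s p^k < 1 and decay afterwards. The induction on N replaces s by s p, which
    is why the bound carried along depends on s. *)
Lemma sum_min_geometric_le5 (R : realFieldType) (p s : R) N :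
  2 <= p -> 0 < s ->
  \sum_(k < N) Num.min (s * p ^+ k) (s * p ^+ k)^-1 <= 5.
Proof.
move=> p2 s0.
suff : \sum_(k < N) Num.min (s * p ^+ k) (s * p ^+ k)^-1 <=
    if 1 <= s then 2 / s else 5 - 2 * s.
  move/le_trans; apply; case: ifPn => [s1|_]; last by lra.
  by rewrite ler_pdivrMr//; lra.
elim: N s s0 => [|N IH] s s0.
  rewrite big_ord0; case: ifPn => [s1|]; first by rewrite divr_ge0// ltW.
  by rewrite -ltNge => s1; lra.
have sp0 : 0 < s * p by rewrite mulr_gt0//; lra.
rewrite big_ord_recl expr0 mulr1.
under eq_bigr => k _ do rewrite lift0 exprS mulrA.
have {}IH := IH _ sp0.
have sp2 : 2 * s <= s * p by nra.
have spi : s * p * (s * p)^-1 = 1 by rewrite mulfV// gt_eqF.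
have si : s * s^-1 = 1 by rewrite mulfV// gt_eqF.
have si0 : 0 < s^-1 by rewrite invr_gt0.
have spi0 : 0 < (s * p)^-1 by rewrite invr_gt0.
have m1 : Num.min s s^-1 <= s by rewrite ge_min lexx.
have m2 : Num.min s s^-1 <= s^-1 by rewrite ge_min lexx orbT.
have H : 2 * (s * p)^-1 <= s^-1.
  have : (s * p)^-1 <= (2 * s)^-1 by rewrite lef_pV2 ?posrE//; lra.
  by rewrite (invfM 2 s); lra.
case: (leP 1 s) IH => [s1|s1].
  case: ifPn => [_|]; last by rewrite -ltNge; nra.
  by move: m1 m2 H; lra.
case: ifPn => [sp1|]; rewrite -?ltNge => IH.
  have : (s * p)^-1 <= 1 by rewrite invf_le1.
  by move: m1 m2 H; lra.
by move: m1 m2 H; lra.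
Qed.

(** The term C(m, 2) r^(m - 2) (1 - r)^2 of the binomial expansion of
    (r + (1 - r))^m = 1 is at most 1, and m^2 <= 4 C(m, 2). *)
Lemma sqr_mul_pow_le (R : realFieldType) (r : R) m : 0 <= r -> r <= 1 ->
  (2 <= m)%N -> (m%:R * (1 - r)) ^+ 2 * r ^+ (m - 2) <= 4.
Proof.
move=> r0 r1 m2.
have x0 : 0 <= 1 - r by rewrite subr_ge0.
have H : (1 - r) ^+ 2 * r ^+ (m - 2) *+ 'C(m, 2) <= 1.
  have E : (r + (1 - r)) ^+ m = 1 by rewrite subrKC expr1n.
  rewrite -[leRHS]E [leRHS]exprDn (bigD1 (@Ordinal m.+1 2 (m2 : (2 < m.+1)%N)))//= mulrC.
  rewrite lerDl sumr_ge0// => i _.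
  by rewrite mulrn_wge0// mulr_ge0// exprn_ge0.
have B : (m ^ 2 <= 4 * 'C(m, 2))%N.
  have : ('C(m, 2).*2 = m * m.-1)%N.
    by rewrite bin2 even_halfK//; case: m {m2 H} => //= m; rewrite oddM /=; case: (odd m).
  move: 'C(_, _) => b; rewrite -mul2n expnS expn1 => bE.
  by case: m m2 {H} bE => // k k1 /=; nia.
have {}B : (m%:R ^+ 2 : R) <= 4 * 'C(m, 2)%:R.
  by rewrite -natrX -natrM ler_nat.
have P0 : 0 <= (1 - r) ^+ 2 * r ^+ (m - 2) by rewrite mulr_ge0// exprn_ge0.
rewrite exprMn -mulrA; move: H P0; rewrite -mulr_natr.
by set P := _ * r ^+ _; nra.
Qed.

(** * Lacunary sums with slowly varying coefficients *)

(** Slow variation of e at the scale 1 - r. The first condition bounds its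
    growth towards 1; the second, almost monotonicity of e r / (1 - r) with
    denominators cleared, bounds its decay. *)
Definition almost_decreasing (R : realType) (K : R) (e : R -> R) :=
  forall r t, 0 <= r -> r <= t -> t < 1 -> e t <= K * e r.
Definition almost_linear_decay (R : realType) (K : R) (e : R -> R) :=
  forall r t, 0 <= r -> r <= t -> t < 1 -> (1 - t) * e r <= K * (1 - r) * e t.

(** One term of the derivative of a lacunary series with
    coefficients sqrt (e (1 - 1 / m)), in the scale u = m (1 - r). For u <= 1
    the coefficient may exceed sqrt (e r), but only by the factor u^(-1/2)
    allowed by [almost_linear_decay]; for u >= 1 the power of r wins. *)
Lemma lacunary_term_le (R : realType) (K : R) (e : R -> R) (r : R) (m : nat) :
  0 < K -> (forall t, 0 <= t -> t < 1 -> 0 < e t) ->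
  almost_decreasing K e -> almost_linear_decay K e ->
  0 <= r -> r < 1 -> (2 <= m)%N ->
  Num.sqrt (e (1 - m%:R^-1)) * m%:R * r ^+ (m - 2) * (1 - r) <=
  4 * (Num.sqrt K * Num.sqrt (e r)) *
    Num.min (Num.sqrt (m%:R * (1 - r))) (Num.sqrt (m%:R * (1 - r)))^-1.
Proof.
move=> K0 epos e1 e2 r0 r1 m2.
have m0 : 0 < m%:R :> R by rewrite ltr0n; lia.
have m1 : 1 < m%:R :> R by rewrite ltr1n; lia.
have mi0 : 0 < m%:R^-1 :> R by rewrite invr_gt0.
have mi1 : m%:R^-1 < 1 :> R by rewrite invf_lt1.
have mim : m%:R * m%:R^-1 = 1 :> R by rewrite mulfV// gt_eqF.
have x0 : 0 < 1 - r by rewrite subr_gt0.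
have := sqr_mul_pow_le r0 (ltW r1) m2.
have P0 : 0 <= r ^+ (m - 2) by rewrite exprn_ge0.
have P1 : r ^+ (m - 2) <= 1 by rewrite exprn_ile1// ltW.
set P := r ^+ (m - 2) in P0 P1 *; set u := m%:R * (1 - r) => uP.
have u0 : 0 < u by rewrite mulr_gt0.
set a := 1 - m%:R^-1.
have a0 : 0 < a by rewrite subr_gt0.
have a1 : a < 1 by rewrite /a; lra.
have er0 := epos _ r0 r1; have ea0 := epos _ (ltW a0) a1.
have -> : Num.sqrt (e a) * m%:R * P * (1 - r) = Num.sqrt (e a * (u * P) ^+ 2).
  rewrite sqrtrM ?(ltW ea0)// sqrtr_sqr ger0_norm ?mulr_ge0 ?(ltW u0) ?(ltW x0)//.
  by rewrite /u; ring.
have four (x : R) : 0 <= x -> 4 * Num.sqrt x = Num.sqrt (16 * x).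
  move=> ?; rewrite sqrtrM//; congr (_ * _).
  by rewrite (_ : 16 = 4 ^+ 2) ?sqrtr_sqr ?ger0_norm//; ring.
rewrite -sqrtrM ?(ltW K0)// four ?mulr_ge0 ?(ltW K0) ?(ltW er0)//.
rewrite -sqrtrV ?(ltW u0)//.
have B : e a * (u * P) ^+ 2 <= 16 * (K * e r) * Num.min u u^-1.
  have ui : u * u^-1 = 1 by rewrite mulfV// gt_eqF.
  have ui0 : 0 < u^-1 by rewrite invr_gt0.
  have up0 : 0 <= u * P by rewrite mulr_ge0// ltW.
  have [u1|u1] := leP u 1.
    have -> : Num.min u u^-1 = u.
      by apply/min_idPl; rewrite -(mul1r u^-1) ler_pdivlMr//; nra.
    have ra : a <= r by rewrite /a; move: u1; rewrite /u; nra.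
    have := e2 _ _ (ltW a0) ra r1; rewrite {2}/a => H.
    have H2 : u * e a <= K * e r.
      have -> : u * e a = m%:R * ((1 - r) * e a) by rewrite /u; ring.
      have -> : K * e r = m%:R * (K * (1 - (1 - m%:R^-1)) * e r).
        transitivity (K * e r * (m%:R * m%:R^-1)); first by rewrite mim mulr1.
        by ring.
      by rewrite ler_pM2l.
    have Q : P ^+ 2 <= 1 by rewrite expr_le1.
    have -> : e a * (u * P) ^+ 2 = u * e a * (u * P ^+ 2) by ring.
    apply: (@le_trans _ _ (K * e r * u)); last by nra.
    apply: ler_pM => //; first by rewrite mulr_ge0// ltW.
      by rewrite mulr_ge0 ?sqr_ge0// ltW.
    by rewrite -[leRHS]mulr1 ler_pM2l.
  have -> : Num.min u u^-1 = u^-1.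
    by apply/min_idPr; rewrite -(mul1r u^-1) ler_pdivrMr//; nra.
  have ra : r <= a by rewrite /a; move: u1; rewrite /u; nra.
  have H := e1 _ _ r0 ra a1.
  (* u^2 P is bounded by 4, and so is u P because 1 <= u. *)
  have Q : u * (u * P) ^+ 2 <= 16.
    have -> : u * (u * P) ^+ 2 = (u ^+ 2 * P) * (u * P) by ring.
    have : u * P <= u ^+ 2 * P by rewrite expr2 ler_wpM2r//; nra.
    move: uP up0; set X := u ^+ 2 * P; set Y := u * P; nra.
  have Q' : (u * P) ^+ 2 <= 16 * u^-1.
    by rewrite -(ler_pM2l u0) [leRHS]mulrCA ui mulr1.
  have -> : 16 * (K * e r) * u^-1 = (K * e r) * (16 * u^-1) by ring.
  by apply: ler_pM => //; rewrite ?sqr_ge0// ltW.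
rewrite (_ : Num.min _ _ = Num.sqrt (Num.min u u^-1)); last first.
  have [uu|uu] := leP u u^-1.
    by apply/min_idPl; exact: ler_wsqrtr.
  by apply/min_idPr; exact/ler_wsqrtr/ltW.
rewrite -sqrtrM; last by rewrite mulr_ge0// mulr_ge0 ?ltW.
exact: ler_wsqrtr.
Qed.

(** Exponents p^(2 (k + 1)): squares, so that the square roots in
    [lacunary_term_le] become powers of p; starting at k + 1, so that the
    derivative of the series vanishes at 0, where wstar is singular. *)
Definition gap_exp (p k : nat) := ((p ^ k.+1) ^ 2)%N.

Definition lacunary_coef (R : realType) (e : R -> R) (p k : nat) : R :=
  Num.sqrt (e (1 - (gap_exp p k)%:R^-1)).

Lemma gap_exp_ge2 p k : (2 <= p)%N -> (2 <= gap_exp p k)%N.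
Proof.
move=> p2; have : (0 < p ^ k)%N by rewrite expn_gt0; lia.
by rewrite /gap_exp expnS !expnS expn0; nia.
Qed.

Lemma gap_expS p k : gap_exp p k.+1 = (p ^ 2 * gap_exp p k)%N.
Proof. by rewrite /gap_exp [(p ^ k.+2)%N]expnS expnMn. Qed.

Lemma ltn_gap_exp p k : (2 <= p)%N -> (k.+1 < gap_exp p k)%N.
Proof.
move=> p2; apply: (leq_trans (ltn_expl k.+1 p2)).
by rewrite /gap_exp -mulnn leq_pmulr// expn_gt0 ltnW.
Qed.

Lemma gap_expV_lt1 (R : realType) p k : (2 <= p)%N ->
  0 < (gap_exp p k)%:R^-1 :> R /\ (gap_exp p k)%:R^-1 < 1 :> R.
Proof.
move=> /(gap_exp_ge2 k) m2.
have m0 : 0 < (gap_exp p k)%:R :> R by rewrite ltr0n (ltn_trans _ m2).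
by rewrite invr_gt0 invf_lt1// ltr1n.
Qed.

Lemma sqrt_gap_expM (R : realType) p k (x : R) : 0 <= x ->
  Num.sqrt ((gap_exp p k)%:R * x) = p%:R * Num.sqrt x * p%:R ^+ k.
Proof.
move=> x0; rewrite sqrtrM ?ler0n// natrX sqrtr_sqr ger0_norm ?ler0n//.
by rewrite natrX exprS; ring.
Qed.

Lemma bernoulli_le (R : realFieldType) (r : R) m : 0 <= r -> r <= 1 ->
  1 + m%:R * (r - 1) <= r ^+ m.
Proof.
move=> r0 r1; elim: m => [|m IH]; first by rewrite mul0r addr0 expr0.
rewrite exprS -natr1; have := ler_wpM2l r0 IH.
have : 0 <= m%:R * (1 - r) ^+ 2 by rewrite mulr_ge0// sqr_ge0.
set P := r * r ^+ m; lra.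
Qed.

#[local] Opaque gap_exp.

Section lacunary_estimates.
Context (R : realType) (K : R) (e : R -> R) (p : nat).
Hypotheses (K0 : 0 < K) (epos : forall t, 0 <= t -> t < 1 -> 0 < e t)
  (e1 : almost_decreasing K e) (e2 : almost_linear_decay K e) (p2 : (2 <= p)%N).

Let p0 : 0 < p%:R :> R. Proof. by rewrite ltr0n; lia. Qed.

(** In the scale u = m (1 - r) the exponents form a geometric progression, so
    the bounds of [lacunary_term_le] add up to a two-sided geometric sum. *)
Lemma lacunary_sum_le (r : R) N : 0 <= r -> r < 1 ->
  (\sum_(k < N) lacunary_coef e p k * (gap_exp p k)%:R * r ^+ (gap_exp p k - 2))
    * (1 - r) <= 20 * (Num.sqrt K * Num.sqrt (e r)).
Proof.
move=> r0 r1; have x0 : 0 < 1 - r by rewrite subr_gt0.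
pose s := p%:R * Num.sqrt (1 - r).
have s0 : 0 < s by rewrite mulr_gt0// sqrtr_gt0.
rewrite mulr_suml; apply: (@le_trans _ _ (\sum_(k < N)
  4 * (Num.sqrt K * Num.sqrt (e r)) * Num.min (s * p%:R ^+ k) (s * p%:R ^+ k)^-1)).
  apply: ler_sum => k _.
  have := lacunary_term_le K0 epos e1 e2 r0 r1 (gap_exp_ge2 k p2).
  by rewrite sqrt_gap_expM// ltW.
rewrite -mulr_sumr.
have := @sum_min_geometric_le5 R p%:R s N.
rewrite ler_nat => /(_ p2 s0).
have : 0 <= Num.sqrt K * Num.sqrt (e r) by rewrite mulr_ge0// sqrtr_ge0.
set S := \sum_(_ < _) _; set Q := _ * Num.sqrt _; nra.
Qed.

Lemma lacunary_coef_gt0 k : 0 < lacunary_coef e p k.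
Proof.
have [a b] := gap_expV_lt1 R k p2.
by rewrite sqrtr_gt0 epos// ?subr_ge0 ?ltrBlDr ?ltrDl// ltW.
Qed.

(** Trading powers of p for powers of 2 keeps the factor 1 / p, which makes
    the off-diagonal terms negligible when p is large. *)
Lemma expr_ratio_le (k n : nat) : (k < n)%N ->
  p%:R ^+ k / p%:R ^+ n <= 2 / p%:R * (2 ^+ k / 2 ^+ n) :> R.
Proof.
move=> kn; pose j := (n - k.+1)%N.
have E (a : R) : 0 < a -> a ^+ k / a ^+ n = a^-1 * (a ^+ j)^-1.
  move=> a0; have -> : n = (k + j.+1)%N by rewrite /j; lia.
  by rewrite exprD exprS; field; rewrite !gt_eqF// exprn_gt0.
rewrite !E//.
have -> : 2 / p%:R * (2^-1 * (2 ^+ j)^-1) = p%:R^-1 * (2 ^+ j)^-1 :> R.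
  by field; rewrite !gt_eqF ?exprn_gt0.
rewrite ler_pM2l ?invr_gt0// lef_pV2 ?posrE ?exprn_gt0//.
by apply: lerXn2r; rewrite ?nnegrE ?(ltW p0)// ler_nat.
Qed.

(** On the circle of radius r with m_n (1 - r) of order 1 the n-th term is
    at least c_n / 128 after multiplication by 1 - r, while the other terms
    together are at most 320 K c_n / p by [lacunary_term_le]. *)
Lemma lacunary_dominant_term (r : R) n N : 320 * 256 * K <= p%:R ->
  (n < N)%N -> 0 <= r -> r < 1 ->
  1 / 64 <= (gap_exp p n)%:R * (1 - r) -> (gap_exp p n)%:R * (1 - r) <= 1 / 2 ->
  lacunary_coef e p n / 256 <=
  (lacunary_coef e p n * (gap_exp p n)%:R * r ^+ (gap_exp p n).-1 -
   \sum_(k < N | k != n :> nat)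
     lacunary_coef e p k * (gap_exp p k)%:R * r ^+ (gap_exp p k).-1) * (1 - r).
Proof.
move=> pK nN r0 r1 u1 u2; have x0 : 0 < 1 - r by rewrite subr_gt0.
have K0' := ltW K0; have r1' := ltW r1.
have cn0 := lacunary_coef_gt0 n.
pose X k := Num.sqrt ((gap_exp p k)%:R * (1 - r)).
have XE k : X k = p%:R * Num.sqrt (1 - r) * p%:R ^+ k.
  by rewrite /X sqrt_gap_expM// ltW.
have X0 k : 0 < X k.
  by rewrite XE mulr_gt0 ?exprn_gt0// mulr_gt0// sqrtr_gt0.
have Xn1 : 1 / 8 <= X n.
  rewrite (_ : 1 / 8 = Num.sqrt ((1 / 8) ^+ 2)); last first.
    by rewrite sqrtr_sqr ger0_norm// divr_ge0.
  by apply: ler_wsqrtr; apply: le_trans u1; lra.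
have Xn2 : X n <= 1.
  by rewrite -[leRHS]sqrtr1; apply: ler_wsqrtr; lra.
have pk k : 0 < p%:R ^+ k :> R by rewrite exprn_gt0.
have XX k : X k = X n * (p%:R ^+ k / p%:R ^+ n).
  by rewrite !XE; field; rewrite gt_eqF.
have tk k : 0 < 2 ^+ k :> R by rewrite exprn_gt0.
(* The bounds on the terms involve e r; this brings them back to c_n. *)
have ee : Num.sqrt (e r) <= Num.sqrt K * lacunary_coef e p n.
  rewrite /lacunary_coef -sqrtrM//; apply: ler_wsqrtr; apply: e1 => //.
    by rewrite subr_ge0 ltW//; have [] := gap_expV_lt1 R n p2.
  have M0 : 0 < (gap_exp p n)%:R :> R.
    by rewrite -invr_gt0; have [] := gap_expV_lt1 R n p2.
  rewrite lerBlDr -lerBlDl -(ler_pM2l M0) mulfV ?gt_eqF//.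
  by apply: le_trans u2 _; rewrite ler_pdivrMr// mul1r ler1n.
have main : lacunary_coef e p n / 128 <=
    lacunary_coef e p n * (gap_exp p n)%:R * r ^+ (gap_exp p n).-1 * (1 - r).
  have H : 1 / 2 <= r ^+ (gap_exp p n).-1.
    apply: (@le_trans _ _ (r ^+ gap_exp p n)); last first.
      by apply: ler_wiXn2l => //; rewrite leq_pred.
    apply: (@le_trans _ _ (1 + (gap_exp p n)%:R * (r - 1))).
      by move: u2; rewrite !mulrBr; lra.
    exact: bernoulli_le.
  have -> : lacunary_coef e p n * (gap_exp p n)%:R * r ^+ (gap_exp p n).-1 * (1 - r)
    = lacunary_coef e p n * (((gap_exp p n)%:R * (1 - r)) * r ^+ (gap_exp p n).-1).
    by ring.
  by apply: ler_wpM2l; [exact: ltW|nra].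
have rest : (\sum_(k < N | k != n :> nat) lacunary_coef e p k *
    (gap_exp p k)%:R * r ^+ (gap_exp p k).-1) * (1 - r) <=
    4 * (Num.sqrt K * Num.sqrt (e r)) * (16 / p%:R) * 5.
  have Q0 : 0 <= 4 * (Num.sqrt K * Num.sqrt (e r)) by rewrite !mulr_ge0// sqrtr_ge0.
  have := @sum_min_geometric_le5 R 2 (2 ^+ n)^-1 N (lexx _).
  rewrite invr_gt0 => /(_ (tk n)) S5.
  apply: le_trans (ler_wpM2l _ S5); last by rewrite mulr_ge0// divr_ge0// ltW.
  rewrite mulr_suml mulr_sumr big_mkcond/=; apply: ler_sum => k _.
  case: ifPn => [kn|_]; last first.
    apply: mulr_ge0; first by rewrite mulr_ge0// divr_ge0// ltW.
    by rewrite le_min invr_ge0 andbb; apply/ltW/mulr_gt0; rewrite ?invr_gt0.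
  apply: (@le_trans _ _ (4 * (Num.sqrt K * Num.sqrt (e r)) * Num.min (X k) (X k)^-1)).
    apply: le_trans (lacunary_term_le K0 epos e1 e2 r0 r1 (gap_exp_ge2 k p2)).
    rewrite -/(lacunary_coef e p k) ler_wpM2r ?(ltW x0)// ler_wpM2l//.
      by rewrite mulr_ge0// ltW// lacunary_coef_gt0.
    by apply: ler_wiXn2l => //; rewrite -subn1 leq_sub2l.
  rewrite -[leRHS]mulrA ler_wpM2l//.
  have [kn'|nk] := ltnP k n.
    rewrite (_ : Num.min (_ * _) _ = 2 ^+ k / 2 ^+ n); last first.
      rewrite mulrC; apply/min_idPl.
      rewrite invfM invrK [leRHS]mulrC; apply: (@le_trans _ _ 1).
        by rewrite ler_pdivrMr// mul1r ler_weXn2l ?ler1n// ltnW.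
      by rewrite ler_pdivlMr// mul1r ler_weXn2l ?ler1n// ltnW.
    rewrite ge_min XX; apply/orP; left.
    have := expr_ratio_le kn'.
    have : 0 <= p%:R ^+ k / p%:R ^+ n :> R by rewrite divr_ge0// ltW.
    have : 0 <= 1 / p%:R * (2 ^+ k / 2 ^+ n) :> R.
      by rewrite !mulr_ge0// ?invr_ge0 ltW.
    rewrite !mul1r -!mulrA; set A := p%:R^-1 * _; set B := p%:R ^+ k / _; nra.
  have {nk} nk : (n < k)%N by rewrite ltn_neqAle eq_sym kn.
  rewrite (_ : Num.min (_ * _) _ = 2 ^+ n / 2 ^+ k); last first.
    rewrite mulrC invfM invrK [X in Num.min _ X]mulrC; apply/min_idPr.
    apply: (@le_trans _ _ 1).
      by rewrite ler_pdivrMr// mul1r ler_weXn2l ?ler1n// ltnW.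
    by rewrite ler_pdivlMr// mul1r ler_weXn2l ?ler1n// ltnW.
  rewrite ge_min; apply/orP; right.
  have -> : (X k)^-1 = (X n)^-1 * (p%:R ^+ n / p%:R ^+ k).
    by rewrite XX; field; rewrite !gt_eqF.
  have := expr_ratio_le nk.
  have : (X n)^-1 <= 8.
    by rewrite -[leRHS]invrK lef_pV2 ?posrE ?invr_gt0//; lra.
  have : 0 < (X n)^-1 by rewrite invr_gt0.
  have : 0 <= p%:R ^+ n / p%:R ^+ k :> R by rewrite divr_ge0// ltW.
  rewrite -!mulrA; set A := p%:R^-1 * _; set B := p%:R ^+ n / _; nra.
have QK : Num.sqrt K * Num.sqrt (e r) <= K * lacunary_coef e p n.
  by have := ler_wpM2l (sqrtr_ge0 K) ee; rewrite mulrA -expr2 sqr_sqrtr.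
have pi : K / p%:R <= 1 / (320 * 256) by rewrite ler_pdivrMr//; lra.
have rest' : 4 * (Num.sqrt K * Num.sqrt (e r)) * (16 / p%:R) * 5 <=
    lacunary_coef e p n / 256.
  apply: (@le_trans _ _ (4 * (K * lacunary_coef e p n) * (16 / p%:R) * 5)).
    rewrite ler_pM2r// ler_pM2r ?divr_gt0//; lra.
  have -> : 4 * (K * lacunary_coef e p n) * (16 / p%:R) * 5 =
    320 * lacunary_coef e p n * (K / p%:R) by field; rewrite gt_eqF.
  by nra.
rewrite mulrBl; lra.
Qed.

End lacunary_estimates.

(** * Tails of a radial weight *)

Definition tail (R : realType) (f : R -> R) (r : R) : R :=
  \int[@lebesgue_measure R]_(s in `[r, 1[) f s.

(** This is (1 - r) / psi r, the size of |g'|^2 (1 - r)^2 for which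
    |g'|^2 wstar is of the order of the weight. *)
Definition decay (R : realType) (f : R -> R) (r : R) : R :=
  (1 - r) * f r / tail f r.

Lemma measure_itvco (R : realType) (a b : R) : a <= b ->
  @lebesgue_measure R `[a, b[%classic = (b - a)%:E.
Proof.
move=> ab; rewrite lebesgue_measure_itv/= lte_fin.
by move: ab; rewrite le_eqVlt => /predU1P[->|->//]; rewrite ltxx subrr.
Qed.

Section radial_profile.
Context (R : realType) (f : R -> R).
Notation mu := (@lebesgue_measure R).
Hypotheses (fpos : forall s, 0 <= s -> s < 1 -> 0 < f s)
  (fcont : forall s, 0 <= s -> s < 1 -> {for s, continuous f})
  (fint : mu.-integrable `[0, 1[ (EFin \o f)).

Lemma itv_tailP (r s : R) : `[r, 1[%classic s <-> r <= s /\ s < 1.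
Proof. by rewrite /= in_itv/=; split => [/andP[]|[-> ->]]. Qed.

Lemma integrable_profile (D : set R) : measurable D -> D `<=` `[0, 1[ ->
  mu.-integrable D (EFin \o f).
Proof. by move=> mD D01; apply: integrableS fint. Qed.

Lemma integrable_tail (r : R) : 0 <= r -> mu.-integrable `[r, 1[ (EFin \o f).
Proof.
move=> r0; apply: integrable_profile => // s /itv_tailP[rs s1].
by apply/itv_tailP; split => //; exact: le_trans rs.
Qed.

Lemma tail_split (a b : R) : 0 <= a -> a <= b -> b <= 1 ->
  tail f a = \int[mu]_(s in `[a, b[) f s + tail f b.
Proof.
move=> a0 ab b1; rewrite /tail (@itv_bndbnd_setU _ _ _ (BLeft b)) ?bnd_simp//.
rewrite Rintegral_setU//=.
  by rewrite -itv_bndbnd_setU ?bnd_simp//; exact: integrable_tail.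
apply/disj_setPS => y [/=]; rewrite 2!in_itv/= => /andP[_ yb] /andP[].
by rewrite leNgt yb.
Qed.

Lemma tail_ge0 (r : R) : 0 <= r -> 0 <= tail f r.
Proof.
move=> r0; apply: Rintegral_ge0 => s /itv_tailP[rs s1].
by rewrite ltW// fpos// (le_trans r0).
Qed.

Lemma le_tail (a b : R) : 0 <= a -> a <= b -> b <= 1 -> tail f b <= tail f a.
Proof.
move=> a0 ab b1; rewrite (tail_split a0 ab b1) lerDr.
apply: Rintegral_ge0 => s /=; rewrite in_itv/= => /andP[rs s1].
by rewrite ltW// fpos// ?(le_trans a0)// (lt_le_trans s1).
Qed.

Lemma tail_sub_le (a b M : R) : 0 <= a -> a <= b -> b <= 1 ->
  (forall s, a <= s -> s < b -> f s <= M) -> tail f a - tail f b <= M * (b - a).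
Proof.
move=> a0 ab b1 fM; rewrite (tail_split a0 ab b1) addrK.
have : \int[mu]_(s in `[a, b[) f s <= \int[mu]_(s in `[a, b[) M.
  apply: le_Rintegral => //.
  - apply: integrable_profile => // s /=; rewrite in_itv/= => /andP[rs s1].
    by rewrite in_itv/= (le_trans a0)//= (lt_le_trans s1).
  - apply: measurable_bounded_integrable => //; last exact: bounded_cst.
    by rewrite [X in (X < _)%E](measure_itvco ab) ltry.
  - by move=> s /=; rewrite in_itv/= => /andP[rs s1]; exact: fM.
by rewrite Rintegral_cst// [X in fine X](measure_itvco ab).
Qed.

Lemma tail_sub_ge (a b M : R) : 0 <= a -> a <= b -> b <= 1 ->
  (forall s, a <= s -> s < b -> M <= f s) -> M * (b - a) <= tail f a - tail f b.
Proof.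
move=> a0 ab b1 fM; rewrite (tail_split a0 ab b1) addrK.
have : \int[mu]_(s in `[a, b[) M <= \int[mu]_(s in `[a, b[) f s.
  apply: le_Rintegral => //.
  - apply: measurable_bounded_integrable => //; last exact: bounded_cst.
    by rewrite [X in (X < _)%E](measure_itvco ab) ltry.
  - apply: integrable_profile => // s /=; rewrite in_itv/= => /andP[rs s1].
    by rewrite in_itv/= (le_trans a0)//= (lt_le_trans s1).
  - by move=> s /=; rewrite in_itv/= => /andP[rs s1]; exact: fM.
by rewrite Rintegral_cst// [X in fine X](measure_itvco ab).
Qed.

Lemma tail_gt0 (r : R) : 0 <= r -> r < 1 -> 0 < tail f r.
Proof.
move=> r0 r1; pose b := (r + 1) / 2.
have rb : r < b by rewrite /b; lra.
have b1 : b < 1 by rewrite /b; lra.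
have [|c] := @EVT_min _ f _ _ (ltW rb).
  apply: continuous_in_subspaceT => s; rewrite inE/= in_itv/= => /andP[rs sb].
  by apply: fcont; [exact: le_trans rs|exact: le_lt_trans b1].
rewrite in_itv/= => /andP[rc cb] cmin.
have fc : 0 < f c by apply: fpos; [exact: le_trans rc|exact: le_lt_trans b1].
have : f c * (b - r) <= tail f r - tail f b.
  apply: tail_sub_ge; rewrite ?(ltW rb) ?(ltW b1)// => s rs sb.
  by apply: cmin; rewrite in_itv/= rs ltW.
have : 0 < f c * (b - r) by rewrite mulr_gt0// subr_gt0.
have := tail_ge0 (le_trans r0 (ltW rb)); lra.
Qed.

(** Absolute continuity of the integral. *)
Lemma tail_le_small (eps : R) : 0 < eps ->
  exists2 t, 0 <= t & t < 1 /\ forall s, t <= s -> s <= 1 -> tail f s <= eps.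
Proof.
move=> eps0; pose a n : R := 1 - n.+1%:R^-1.
have a0 n : 0 <= a n by rewrite subr_ge0 invf_le1// ?ler1n ?ltr0n.
have a1 n : a n < 1 by rewrite /a ltrBlDr ltrDl invr_gt0 ltr0n.
have subF n : `[0, a n[%classic `<=` `[0, 1[%classic.
  move=> s /=; rewrite !in_itv/= => /andP[-> /= sa].
  exact: lt_trans (a1 n).
have cov : \bigcup_n `[0, a n[%classic = `[0, 1[%classic.
  apply/seteqP; split => [s [n _]|s /=]; first exact: subF.
  rewrite in_itv/= => /andP[s0 s1].
  have s1' : 0 < 1 - s by rewrite subr_gt0.
  have [N _ /(_ N (leqnn N)) /= HN] := near_infty_natSinv_lt (PosNum s1').
  by exists N => //=; rewrite in_itv/= s0/= ltrBrDr addrC -ltrBrDr.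
have nd : nondecreasing_seq (fun n => `[0, a n[%classic).
  move=> m n mn; apply/subsetPset => s /=; rewrite !in_itv/= => /andP[-> /= sm].
  apply: lt_le_trans sm _; rewrite /a lerD2l lerN2 lef_pV2 ?posrE ?ltr0n//.
  by rewrite ler_nat ltnS.
have := @ge0_nondecreasing_set_cvg_integral _ (measurableTypeR R) R _
  (EFin \o f) (@lebesgue_measure R) nd.
rewrite cov => /(_ (fun=> measurable_itv _)) H.
have {H} H : (\int[mu]_(x in `[0%R, a n[) (EFin \o f) x)%E @[n --> \oo] -->
    (\int[mu]_(x in `[0%R, 1%R[) (EFin \o f) x)%E.
  apply: H => n.
    by have /integrableP[] := integrable_profile (measurable_itv _) (@subF n).
  move=> s /subF /=; rewrite in_itv/= => /andP[s0 s1].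
  by rewrite lee_fin ltW// fpos.
have fin (D : set R) : measurable D -> D `<=` `[0, 1[%classic ->
    (\int[mu]_(x in D) (EFin \o f) x)%E = (\int[mu]_(x in D) f x)%:E.
  move=> mD DD; rewrite /Rintegral fineK//.
  exact: integrable_fin_num (integrable_profile mD DD).
rewrite fin// in H.
have [_ /cvgrPdist_le /(_ _ eps0) [N _ /(_ N (leqnn N)) /=]] := (fine_cvgP _ _).1 H.
rewrite [X in X - _](tail_split (lexx 0) (a0 N) (ltW (a1 N))).
rewrite [X in X - _]addrC addrK ger0_norm ?tail_ge0// => aN.
exists (a N) => //; split => // s aNs s1.
exact: le_trans (le_tail (a0 N) aNs s1) aN.
Qed.

End radial_profile.

Section decay_theory.
Context (R : realType) (f : R -> R).
Notation mu := (@lebesgue_measure R).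
Hypotheses (fpos : forall s, 0 <= s -> s < 1 -> 0 < f s)
  (fcont : forall s, 0 <= s -> s < 1 -> {for s, continuous f})
  (fint : mu.-integrable `[0, 1[ (EFin \o f)).

Let tail_pos := tail_gt0 fpos fcont fint.

Lemma decay_gt0 (r : R) : 0 <= r -> r < 1 -> 0 < decay f r.
Proof.
move=> r0 r1; rewrite divr_gt0//; last exact: tail_pos.
by rewrite mulr_gt0 ?subr_gt0// fpos.
Qed.

(** The quotient psi r / (1 - r) is the inverse of [decay]. *)
Lemma decay_almost_decreasing (C : R) : 0 < C ->
  (forall r t, 0 <= r -> r <= t -> t < 1 ->
    (f r)^-1 * tail f r / (1 - r) <= C * ((f t)^-1 * tail f t / (1 - t))) ->
  almost_decreasing C (decay f).
Proof.
move=> C0 H r t r0 rt t1.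
have t0 := le_trans r0 rt; have r1 := le_lt_trans rt t1.
have E s : 0 <= s -> s < 1 -> (f s)^-1 * tail f s / (1 - s) = (decay f s)^-1.
  move=> s0 s1; rewrite /decay; have := tail_pos s0 s1; have := fpos s0 s1.
  by move=> ? ?; field; rewrite !gt_eqF// subr_gt0.
have := H _ _ r0 rt t1; rewrite !E// => H'.
have er := decay_gt0 r0 r1; have et := decay_gt0 t0 t1.
rewrite -(ler_pM2r (_ : 0 < (decay f t)^-1)) ?invr_gt0// mulfV ?gt_eqF//.
rewrite -(ler_pM2r (_ : 0 < (decay f r)^-1)) ?invr_gt0// mul1r.
by rewrite mulrAC mulfK ?gt_eqF.
Qed.

Lemma decay_almost_linear (C : R) : 0 < C ->
  (forall r t, 0 <= r -> r <= t -> t < 1 -> f r <= C * f t) ->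
  almost_linear_decay C (decay f).
Proof.
move=> C0 H r t r0 rt t1.
have t0 := le_trans r0 rt; have r1 := le_lt_trans rt t1.
have Tr := tail_pos r0 r1; have Tt := tail_pos t0 t1.
have fr := fpos r0 r1; have ft := fpos t0 t1.
have Ttr := le_tail fpos fint r0 rt (ltW t1).
have -> : (1 - t) * decay f r = (1 - t) * (1 - r) * (f r / tail f r).
  by rewrite /decay; field; rewrite gt_eqF.
have -> : C * (1 - r) * decay f t = (1 - t) * (1 - r) * (C * f t / tail f t).
  by rewrite /decay; field; rewrite gt_eqF.
rewrite ler_wpM2l// ?mulr_ge0 ?subr_ge0 ?(ltW t1) ?(ltW r1)//.
apply: ler_pM; [exact: ltW|by rewrite invr_ge0 ltW|exact: H|].
by rewrite lef_pV2 ?posrE.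
Qed.

(** Use f s = decay f s tail f s / (1 - s) and bound the three factors on
    [a, b]. *)
Lemma tail_drop_le (K a b : R) : 0 < K -> almost_decreasing K (decay f) ->
  0 <= a -> a <= b -> b < 1 ->
  tail f a - tail f b <= K * decay f a * tail f a * ((b - a) / (1 - b)).
Proof.
move=> K0 dec a0 ab b1.
have a1 := le_lt_trans ab b1.
rewrite [leRHS]mulrA mulrAC; apply: tail_sub_le => // [|s as_ sb]; first exact: ltW.
have s0 := le_trans a0 as_; have s1 := lt_trans sb b1.
have Ts := tail_pos s0 s1.
have -> : f s = decay f s * tail f s * (1 - s)^-1.
  by rewrite /decay; field; rewrite !gt_eqF// subr_gt0.
have ds := decay_gt0 s0 s1; have da := decay_gt0 a0 a1.
apply: ler_pM => //; first by rewrite mulr_ge0// ltW.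
- by rewrite invr_ge0 subr_ge0 ltW.
- apply: ler_pM; [exact: ltW|exact: ltW|exact: dec|].
  by apply: le_tail => //; exact: ltW.
- by rewrite lef_pV2 ?posrE ?subr_gt0// lerD2l lerN2 ltW.
Qed.

End decay_theory.

(** As u tends to 0, from any index m one can go on until u has been
    halved; the sum of the relative drops over this block is at least 1/2,
    because u is at most u m on it. There are infinitely many disjoint
    blocks. *)
Lemma sum_relative_drop_unbounded (R : realFieldType) (A : R) (u d : nat -> R) :
  0 < A -> (forall k, 0 < u k) -> (forall k, 0 <= d k) ->
  {homo u : m n / (m <= n)%N >-> n <= m} ->
  (forall eps, 0 < eps -> exists n, u n <= eps) ->
  (forall k, u k - u k.+1 <= A * d k * u k) ->
  forall j : nat, exists N, j%:R <= 2 * A * \sum_(k < N) d k.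
Proof.
move=> A0 u0 d0 nincr lim drop.
have block m : exists2 N, (m <= N)%N & 1 <= 2 * A * \sum_(m <= k < N) d k.
  have [N uN] := lim (u m / 2) (divr_gt0 (u0 m) (ltr0Sn _ 1)).
  have um := u0 m.
  exists (maxn m N); first exact: leq_maxl.
  have uN' : u (maxn m N) <= u m / 2 by apply: le_trans uN; apply: nincr; exact: leq_maxr.
  have : u m - u (maxn m N) <= A * u m * \sum_(m <= k < maxn m N) d k.
    rewrite -opprB -(telescope_sumr u (leq_maxl m N)) -sumrN mulr_sumr.
    rewrite big_nat_cond [leRHS]big_nat_cond.
    apply: ler_sum => k /andP[/andP[mk _] _]; rewrite opprB.
    apply: le_trans (drop k) _; rewrite mulrAC ler_wpM2r// ler_wpM2l ?(ltW A0)//.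
    exact: nincr.
  rewrite -(ler_pM2r um) mul1r => ?; lra.
elim=> [|j [N IH]].
  by exists 0%N; rewrite big_ord0 mulr0.
have [M NM MH] := block N; exists M.
rewrite -natr1 -(big_mkord xpredT) (@big_cat_nat _ _ _ N)//= mulrDr lerD//.
by rewrite big_mkord.
Qed.

(** Apply [sum_relative_drop_unbounded] to the values of the tail at
    1 - 1 / m_k. From one of these points to the next the distance to 1
    shrinks by the factor p^2, and by [tail_drop_le] the relative drop of the
    tail is at most K p^2 times the decay. *)
Lemma sum_decay_unbounded (R : realType) (f : R -> R) (K : R) (p : nat)
  (fpos : forall s, 0 <= s -> s < 1 -> 0 < f s)
  (fcont : forall s, 0 <= s -> s < 1 -> {for s, continuous f})
  (fint : (@lebesgue_measure R).-integrable `[0, 1[ (EFin \o f)) :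
  0 < K -> almost_decreasing K (decay f) -> (2 <= p)%N ->
  forall T : R, exists N, T <= \sum_(k < N) decay f (1 - (gap_exp p k)%:R^-1).
Proof.
move=> K0 dec p2 T.
have m0 k : 0 < (gap_exp p k)%:R :> R by rewrite ltr0n (ltn_trans _ (gap_exp_ge2 k p2)).
pose r k : R := 1 - (gap_exp p k)%:R^-1.
have r01 k : 0 <= r k /\ r k < 1.
  have [a b] := gap_expV_lt1 R k p2.
  by rewrite /r; split; lra.
have mS k : (gap_exp p k.+1)%:R = p%:R ^+ 2 * (gap_exp p k)%:R :> R.
  by rewrite gap_expS natrM natrX.
have p1 : 1 <= p%:R ^+ 2 :> R by rewrite -natrX ler1n expn_gt0; case: (p) p2.
have rS k : r k <= r k.+1.
  rewrite /r lerD2l lerN2 lef_pV2 ?posrE// mS ler_peMl// ltW//.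
have A0 : 0 < K * p%:R ^+ 2 by rewrite mulr_gt0// (lt_le_trans ltr01).
have [] := @sum_relative_drop_unbounded R (K * p%:R ^+ 2)
  (fun k => tail f (r k)) (fun k => decay f (r k)) A0 _ _ _ _ _
  (Num.bound `|2 * (K * p%:R ^+ 2) * T|).
- by move=> k; have [? ?] := r01 k; exact: tail_gt0.
- by move=> k; have [? ?] := r01 k; apply/ltW/decay_gt0.
- apply: homo_leq => [x|y x z xy yz|k]; [exact: lexx|exact: le_trans yz xy|].
  have [? _] := r01 k; have [_ ?] := r01 k.+1.
  by apply: le_tail => //; exact: ltW.
- move=> eps eps0; have [t t0 [t1 H]] := tail_le_small fpos fint eps0.
  have s1' : 0 < 1 - t by rewrite subr_gt0.
  have [n _ /(_ n (leqnn n)) /= Hn] := near_infty_natSinv_lt (PosNum s1').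
  exists n; apply: H; last by apply/ltW; case: (r01 n).
  rewrite /r lerBrDr -lerBrDl; apply: le_trans (ltW Hn).
  rewrite lef_pV2 ?posrE// ler_nat.
  exact: ltnW (ltn_gap_exp _ _).
- move=> k; have [? _] := r01 k; have [_ ?] := r01 k.+1.
  apply: le_trans (tail_drop_le fpos fcont fint K0 dec _ (rS k) _) _ => //.
  have [_ rk1] := r01 k.
  have -> : K * p%:R ^+ 2 * decay f (r k) * tail f (r k) =
      K * decay f (r k) * tail f (r k) * p%:R ^+ 2 by ring.
  rewrite ler_wpM2l//.
    rewrite mulr_ge0 ?tail_ge0//.
    by rewrite mulr_ge0 ?(ltW K0)//; apply/ltW/decay_gt0.
  rewrite ler_pdivrMr ?subr_gt0//.
  have -> : p%:R ^+ 2 * (1 - r k.+1) = (gap_exp p k)%:R^-1.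
    rewrite /r mS subKr; field.
    by rewrite gt_eqF//= pnatr_eq0 -lt0n (ltnW p2).
  rewrite /r; have [] := gap_expV_lt1 R k.+1 p2; lra.
move=> N HN; exists N.
have A20 : 0 < 2 * (K * p%:R ^+ 2) by rewrite mulr_gt0.
rewrite -(ler_pM2l A20); apply: le_trans HN.
by rewrite ltW// (le_lt_trans (ler_norm _))// archi_boundP.
Qed.

(** * Comparison of the logarithmic average with the tail *)

Section logarithmic_average.
Context (R : realType) (f : R -> R).
Notation mu := (@lebesgue_measure R).
Hypotheses (fpos : forall s, 0 <= s -> s < 1 -> 0 < f s)
  (fint : mu.-integrable `[0, 1[ (EFin \o f)).

(** Both bounds come from ln (1 + x) <= x, applied to s / r and to
    r / s. *)
Lemma ln_ratio_bounds (r s : R) : 0 < r -> r <= s -> s < 1 ->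
  s - r <= ln (s / r) * s <= (1 - r) / r.
Proof.
move=> r0 rs s1; have s0 := lt_le_trans r0 rs.
have sr : 0 < s / r by rewrite divr_gt0.
have rs' : 0 < r / s by rewrite divr_gt0.
have U : ln (s / r) <= (s - r) / r.
  have -> : s / r = 1 + (s - r) / r by field; rewrite gt_eqF.
  apply: le_ln1Dx; rewrite (lt_le_trans (_ : -1 < 0))// ?ltrN10//.
  by rewrite divr_ge0 ?subr_ge0// ltW.
have L : (s - r) / s <= ln (s / r).
  rewrite -[s / r]invrK lnV ?posrE ?invr_gt0// invf_div lerNr.
  have {1}-> : r / s = 1 + - ((s - r) / s) by field; rewrite gt_eqF.
  apply: le_ln1Dx; rewrite ltrN2 ltr_pdivrMr// mul1r; lra.
apply/andP; split; first by rewrite -ler_pdivrMr.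
apply: (@le_trans _ _ ((s - r) / r * s)); first by rewrite ler_pM2r.
rewrite -mulrA mulrCA mulrC ler_pM2r ?invr_gt0//; nra.
Qed.

Lemma integrable_log_average (r : R) : 0 < r -> r < 1 ->
  mu.-integrable `[r, 1[ (EFin \o (fun s => f s * ln (s / r) * s)).
Proof.
move=> r0 r1.
have fr := integrable_tail fint (ltW r0).
have mr : measurable `[r, 1[%classic by exact: measurable_itv.
apply: (le_integrable _ _ _ (integrableZl _ ((1 - r) / r) fr)) => //.
  apply/measurable_EFinP; apply: measurable_funM; last exact: measurable_id.
  apply: measurable_funM.
    by case/integrableP : fr => /measurable_EFinP.
  apply: (measurableT_comp (@measurable_ln R)).
  by apply: measurable_funM; [exact: measurable_id|exact: measurable_cst].
move=> s /itv_tailP[rs s1] /=.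
have /andP[L U] := ln_ratio_bounds r0 rs s1.
have fs : 0 < f s by rewrite fpos// (le_trans (ltW r0)).
rewrite lee_fin -mulrA [X in _ <= `|X|]mulrC !(normrM (f s)) ler_wpM2l//.
have X0 : 0 <= ln (s / r) * s by apply: le_trans L; rewrite subr_ge0.
by rewrite (ger0_norm X0) (ger0_norm (le_trans X0 U)).
Qed.

Lemma log_average_le (r : R) : 0 < r -> r < 1 ->
  \int[mu]_(s in `[r, 1[) (f s * ln (s / r) * s) <= (1 - r) / r * tail f r.
Proof.
move=> r0 r1; have fr := integrable_tail fint (ltW r0).
have mr : measurable `[r, 1[%classic by exact: measurable_itv.
rewrite /tail -RintegralZl//; apply: le_Rintegral => //.
- exact: integrable_log_average.
- exact: (integrableZl _ ((1 - r) / r) fr).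
- move=> s /itv_tailP[rs s1]; have /andP[L U] := ln_ratio_bounds r0 rs s1.
  have fs : 0 < f s by rewrite fpos// (le_trans (ltW r0)).
  by rewrite -mulrA mulrC ler_pM2r.
Qed.

(** Restrict the integral to the half of [r, 1) away from r, where
    s - r >= (1 - r) / 2. *)
Lemma log_average_ge (r : R) : 0 < r -> r < 1 ->
  (1 - r) / 2 * tail f ((1 + r) / 2) <=
  \int[mu]_(s in `[r, 1[) (f s * ln (s / r) * s).
Proof.
move=> r0 r1; set b := (1 + r) / 2.
have rb : r <= b by rewrite /b; lra.
have b0 := le_trans (ltW r0) rb.
have fb := integrable_tail fint b0.
have sub : `[b, 1[%classic `<=` `[r, 1[%classic.
  by move=> s /itv_tailP[bs s1]; apply/itv_tailP; split => //; exact: le_trans bs.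
have Ir := integrable_log_average r0 r1.
have Ib : mu.-integrable `[b, 1[ (EFin \o (fun s => f s * ln (s / r) * s)).
  exact: integrableS Ir.
have pos s : r <= s -> s < 1 -> 0 <= f s * ln (s / r) * s.
  move=> rs s1; have /andP[L U] := ln_ratio_bounds r0 rs s1.
  have fs : 0 < f s by rewrite fpos// (le_trans (ltW r0)).
  by rewrite -mulrA mulr_ge0 ?(ltW fs)//; apply: le_trans L; rewrite subr_ge0.
apply: (@le_trans _ _ (\int[mu]_(s in `[b, 1[) (f s * ln (s / r) * s))).
  rewrite /tail -RintegralZl//; apply: le_Rintegral => //.
    exact: (integrableZl _ ((1 - r) / 2) fb).
  move=> s /itv_tailP[bs s1]; have rs := le_trans rb bs.
  have /andP[L U] := ln_ratio_bounds r0 rs s1.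
  have fs : 0 < f s by rewrite fpos// (le_trans (ltW r0)).
  rewrite -mulrA mulrC ler_pM2l//; apply: le_trans L; rewrite /b in bs; lra.
rewrite /Rintegral fine_le//.
- exact: integrable_fin_num Ib.
- exact: integrable_fin_num Ir.
apply: ge0_subset_integral => //.
  by case/integrableP : Ir.
by move=> s /itv_tailP[rs s1]; rewrite lee_fin pos.
Qed.

End logarithmic_average.

(** The tail is a real number by truncation, equal to 0 if the integral
    diverges; so a nonzero tail forces integrability near 1, and continuity
    gives it on the rest of the interval. *)
Lemma integrable_of_tail_neq0 (R : realType) (f : R -> R) (r : R)
  (fpos : forall s, 0 <= s -> s < 1 -> 0 < f s)
  (fcont : forall s, 0 <= s -> s < 1 -> {for s, continuous f}) :
  0 <= r -> r < 1 -> tail f r != 0 ->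
  (@lebesgue_measure R).-integrable `[0, 1[ (EFin \o f).
Proof.
move=> r0 r1 T0.
have m01 : measurable_fun (`[0, 1[%classic : set R) f.
  apply: subspace_continuous_measurable_fun => //.
  apply: continuous_in_subspaceT => s; rewrite inE => /itv_tailP[s0 s1].
  exact: fcont.
have fpos' a : 0 <= a -> forall s, `[a, 1[%classic s -> (0 <= (f s)%:E)%E.
  by move=> a0 s /itv_tailP[as_ s1]; rewrite lee_fin ltW// fpos// (le_trans a0).
apply/integrableP; split; first exact/measurable_EFinP.
rewrite [X in (X < _)%E](_ : _ =
    \int[@lebesgue_measure R]_(s in `[0%R, 1%R[) (f s)%:E)%E; last first.
  apply: eq_integral => s; rewrite inE => /(fpos' _ (lexx 0)) ?.
  by rewrite /= ger0_norm.
have E : `[0, 1[%classic = `[0, r[%classic `|` `[r, 1[%classic.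
  by rewrite -itv_bndbnd_setU// bnd_simp// ltW.
rewrite E ge0_integral_setU//; last 3 first.
- by rewrite -E; exact/measurable_EFinP.
- by rewrite -E; exact: fpos'.
- apply/disj_setPS => y [/=]; rewrite 2!in_itv/= => /andP[_ yb] /andP[].
  by rewrite leNgt yb.
apply: lte_add_pinfty.
  have : (@lebesgue_measure R).-integrable `[0, r] (EFin \o f).
    apply: continuous_compact_integrable; first exact: segment_compact.
    apply: continuous_in_subspaceT => s; rewrite inE/= in_itv/= => /andP[s0 s1].
    by apply: fcont => //; exact: le_lt_trans r1.
  move=> Ic; have Ico : (@lebesgue_measure R).-integrable `[0, r[ (EFin \o f).
    apply: integrableS Ic => //; exact: subset_itv_co_cc.
  by rewrite ltey_eq (integrable_fin_num _ Ico).
rewrite ltNge leye_eq; apply: contra_neqN T0 => /eqP H.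
by rewrite /tail /Rintegral H.
Qed.

(** * Comparison of integrals without measurability *)

Section nonmeasurable_integrands.
Context d (T : measurableType d) (R : realType) (mu : {measure set T -> \bar R}).
Local Open Scope ereal_scope.
Import HBNNSimple.

(** The integral of a nonnegative function is the supremum of the
    integrals of the simple functions below it; scaling these proves the
    comparison for arbitrary functions. *)
Lemma ge0_le_integral_scale (f g : T -> \bar R) (M : R) : (0 < M)%R ->
  (forall x, 0 <= f x) -> (forall x, 0 <= g x) -> (forall x, f x <= M%:E * g x) ->
  \int[mu]_x f x <= M%:E * \int[mu]_x g x.
Proof.
move=> M0 f0 g0 fg; rewrite !ge0_integralTE//.
apply: ge_ereal_sup => _ [h /= hf <-].
have Mi0 : (0 <= M^-1)%R by rewrite invr_ge0 ltW.
have -> : sintegral mu h = M%:E * sintegral mu (scale_nnsfun h Mi0).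
  rewrite -sintegralrM; apply: eq_sintegral => x /=.
  by rewrite mulrA divff ?mul1r// gt_eqF.
apply: lee_wpmul2l; first by rewrite lee_fin ltW.
apply: ereal_sup_ubound; exists (scale_nnsfun h Mi0) => //= x.
by rewrite EFinM lee_pdivrMl// (le_trans (hf x)).
Qed.

(** Carleson squares and weighted derivatives, whose measurability is left
    open, are compared with simpler sets and functions by this inequality. *)
Lemma ge0_le_integral_restrict (D E : set T) (f g : T -> \bar R) (M : R) :
  (0 < M)%R -> (forall x, D x -> 0 <= f x) -> (forall x, E x -> 0 <= g x) ->
  (forall x, D x -> 0 < f x -> E x) ->
  (forall x, D x -> E x -> f x <= M%:E * g x) ->
  \int[mu]_(x in D) f x <= M%:E * \int[mu]_(x in E) g x.
Proof.
move=> M0 f0 g0 DE fg; rewrite (integral_mkcond D) (integral_mkcond E).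
have G0 x : 0 <= (g \_ E) x by apply: erestrict_ge0.
apply: ge0_le_integral_scale => //.
  by move=> x; apply: erestrict_ge0.
move=> x; rewrite {1}patchE; case: ifPn => [/set_mem Dx|_]; last first.
  by rewrite mule_ge0// lee_fin ltW.
have := f0 _ Dx; rewrite le_eqVlt => /predU1P[<-|fx].
  by rewrite mule_ge0// lee_fin ltW.
by have Ex := DE _ Dx fx; rewrite patchE mem_set//; exact: fg.
Qed.

(** A simple function below the integrand gives a lower bound. *)
Lemma sum_measure_le_integral (D : set T) (f : T -> R) (N : nat)
    (A : nat -> set T) (c : nat -> R) :
  (forall x, D x -> (0 <= f x)%R) -> (forall n, (0 <= c n)%R) ->
  (forall n, measurable (A n)) -> trivIset setT A ->
  (forall n, (n < N)%N -> A n `<=` D) ->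
  (forall n x, (n < N)%N -> A n x -> (c n <= f x)%R) ->
  \sum_(n < N) (c n)%:E * mu (A n) <= \int[mu]_(x in D) (f x)%:E.
Proof.
move=> f0 c0 mA tA AD cf.
have -> : \sum_(n < N) (c n)%:E * mu (A n) =
    \int[mu]_x (\sum_(n < N) (c n)%:E * (\1_(A n) x)%:E).
  rewrite ge0_integral_sum//; last first.
  - by move=> n x _; rewrite mule_ge0// lee_fin.
  - move=> n; apply: emeasurable_funM; first exact: measurable_cst.
    exact/measurable_EFinP/measurable_indic.
  apply: eq_bigr => n _; rewrite ge0_integralZl_EFin//.
  - by rewrite integral_indic// setIT.
  - exact/measurable_EFinP/measurable_indic.
rewrite -[leRHS]mul1e; apply: ge0_le_integral_restrict => //.
- by move=> x _; rewrite sume_ge0// => n _; rewrite mule_ge0// lee_fin.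
- move=> x _; apply: contraPP => Dx; rewrite big1 ?ltxx// => n _.
  rewrite indicE memNset ?mule0// => Ax; exact/Dx/(AD n).
- move=> x _ Dx; rewrite mul1e.
  have [[n nN Anx]|nA] := pselect (exists2 n, (n < N)%N & A n x); last first.
    rewrite big1 ?lee_fin ?f0// => n _; rewrite indicE memNset ?mule0// => Ax.
    by apply: nA; exists n.
  rewrite (bigD1 (Ordinal nN))//= big1 ?adde0.
    by rewrite indicE mem_set// mule1 lee_fin cf.
  move=> m /eqP mn; rewrite indicE memNset ?mule0// => Amx.
  apply: mn; apply: val_inj => /=; apply: (tA m n I I).
  by exists x.
Qed.

End nonmeasurable_integrands.

(** * Radial integrands along horizontal lines *)

(** The modulus of x + iy, with y first: horizontal lines are used as slices,
    and hypot y is then the function along which to substitute. *)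
Definition hypot (R : realType) (y x : R) : R := Num.sqrt (x ^+ 2 + y ^+ 2).

Section hypot_slices.
Context (R : realType).
Implicit Types x y : R.

Lemma hypot_sq x y : hypot y x ^+ 2 = x ^+ 2 + y ^+ 2.
Proof. by rewrite sqr_sqrtr// addr_ge0// sqr_ge0. Qed.

Lemma hypot_ge0 x y : 0 <= hypot y x. Proof. exact: sqrtr_ge0. Qed.

Lemma hypot_gt0 x y : 0 < x -> 0 < hypot y x.
Proof. by move=> x0; rewrite sqrtr_gt0 ltr_wpDr ?sqr_ge0// exprn_gt0. Qed.

Lemma ltr_hypot x x' y : 0 <= x -> x < x' -> hypot y x < hypot y x'.
Proof.
move=> x0 xx'; have x'0 := le_lt_trans x0 xx'.
by rewrite ltr_sqrt ?ltrD2r ?ltr_wpDr ?sqr_ge0 ?exprn_gt0// ltrXn2r// ltW.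
Qed.

Lemma ler_hypot x x' y : 0 <= x -> x <= x' -> hypot y x <= hypot y x'.
Proof.
by move=> x0 xx'; rewrite ler_wsqrtr// lerD2r lerXn2r// nnegrE (le_trans x0).
Qed.

Lemma is_derive_hypot x y : 0 < x -> is_derive x 1 (hypot y) (x / hypot y x).
Proof.
move=> x0; have h0 : 0 < x ^+ 2 + y ^+ 2.
  by rewrite ltr_wpDr ?sqr_ge0// exprn_gt0.
have D1 := is_derive1_sqrt h0.
have D2 : is_derive x 1 (fun x => x ^+ 2 + y ^+ 2) (2 * x).
  have -> : (fun x => x ^+ 2 + y ^+ 2) = (id ^+ 2 + cst (y ^+ 2)) :> (R -> R).
    by apply/funext => t /=; rewrite !fctE.
  by apply: is_derive_eq; rewrite addr0 /= expr1 [_ *: _]mulr1.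
have := @is_derive1_comp R Num.sqrt _ x _ _ D1 D2; rewrite -[_ \o _]/(hypot y).
suff -> : (2 * Num.sqrt (x ^+ 2 + y ^+ 2))^-1 * (2 * x) = x / hypot y x by [].
by rewrite -/(hypot y x); field; rewrite gt_eqF// hypot_gt0.
Qed.

Lemma continuous_hypot y : continuous (hypot y).
Proof.
move=> x; apply: (continuous_comp (f := fun x => x ^+ 2 + y ^+ 2)).
  by apply: continuousD; [exact: exprn_continuous|exact: cst_continuous].
exact: sqrt_continuous.
Qed.

Lemma derive1_hypot x y : 0 < x -> derive1 (hypot y) x = x / hypot y x.
Proof. by move=> x0; have H := is_derive_hypot y x0; rewrite derive1E derive_val. Qed.

Lemma continuous_derive1_hypot x y : 0 < x -> {for x, continuous (derive1 (hypot y))}.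
Proof.
move=> x0; suff : derive1 (hypot y) t @[t --> x] --> x / hypot y x.
  by rewrite -(derive1_hypot y x0).
have E : {near x, (fun t => t / hypot y t) =1 derive1 (hypot y)}.
  by near do rewrite derive1_hypot//; exact: lt_nbhsr.
apply: (cvg_trans (near_eq_cvg E)).
apply: cvgM; first exact: cvg_id.
by apply: cvgV; [rewrite gt_eqF// hypot_gt0|exact: continuous_hypot].
Unshelve. all: by end_near. Qed.

Section slice.
Context (f : R -> R).
Notation mu := (@lebesgue_measure R).
Hypotheses (fpos : forall s, 0 <= s -> s < 1 -> 0 < f s)
  (fcont : forall s, 0 <= s -> s < 1 -> {for s, continuous f})
  (fint : mu.-integrable `[0, 1[ (EFin \o f)).

(** Substitute s = hypot y x. The derivative of this map is x / s, which is at
    least 1/2 since 1/2 <= x and s < 1. *)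
Lemma integral_hypot_closed_le (y a x0 b : R) : 0 <= a -> 1 / 2 <= x0 -> x0 <= b ->
  a <= hypot y x0 -> hypot y b < 1 ->
  (\int[mu]_(x in `[x0, b]) (f (hypot y x))%:E <= 2%:E * (tail f a)%:E)%E.
Proof.
move=> a0 x0h x0b ax0 b1.
have x00 : 0 < x0 by apply: lt_le_trans x0h.
have incr : {in `[x0, b] &, {homo hypot y : x z / x < z}}.
  move=> x z; rewrite !in_itv/= => /andP[xx _] _ xz.
  by apply: ltr_hypot => //; rewrite ltW// (lt_le_trans x00).
have xpos x : x0 <= x -> 0 < x by exact: lt_le_trans.
have S := @integration_by_substitution_increasing R (hypot y) f x0 b x0b incr.
have {S} : (\int[mu]_(x in `[hypot y x0, hypot y b]) (f x)%:E =
    \int[mu]_(x in `[x0, b]) (((f \o hypot y) * derive1 (hypot y))%R x)%:E)%E.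
  apply: S.
  - move=> x; rewrite in_itv/= => /andP[x0x _].
    by apply: continuous_derive1_hypot; apply: xpos; exact: ltW.
  - apply/cvg_ex; exists (derive1 (hypot y) x0); apply: cvg_at_right_filter.
    exact: continuous_derive1_hypot.
  - apply/cvg_ex; exists (derive1 (hypot y) b); apply: cvg_at_left_filter.
    by apply: continuous_derive1_hypot; exact: xpos.
  - split.
    + move=> x; rewrite in_itv/= => /andP[x0x _].
      by have [] := is_derive_hypot y (xpos _ (ltW x0x)).
    + by apply: cvg_at_right_filter; exact: continuous_hypot.
    + by apply: cvg_at_left_filter; exact: continuous_hypot.
  - apply: continuous_in_subspaceT => s; rewrite inE/= in_itv/= => /andP[s0 s1].
    by apply: fcont; [exact: le_trans (hypot_ge0 _ _) s0|exact: le_lt_trans b1].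
move=> S.
have hb x : x0 <= x -> x <= b -> hypot y x < 1 /\ a <= hypot y x.
  move=> xx xb; split; first by apply: le_lt_trans b1; rewrite ler_hypot// ltW ?xpos.
  by apply: le_trans ax0 _; rewrite ler_hypot// ltW.
apply: (@le_trans _ _ (2%:E * \int[mu]_(x in `[x0, b])
    (((f \o hypot y) * derive1 (hypot y))%R x)%:E)%E).
  apply: ge0_le_integral_restrict => //.
  - move=> x /=; rewrite in_itv/= lee_fin => /andP[xx xb].
    by have [h1 h2] := hb _ xx xb; rewrite ltW// fpos// hypot_ge0.
  - move=> x /=; rewrite in_itv/= lee_fin => /andP[xx xb].
    have [h1 h2] := hb _ xx xb; have xp := xpos _ xx.
    rewrite fctE/= derive1_hypot// mulr_ge0 ?divr_ge0 ?hypot_ge0 ?(ltW xp)//.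
    by rewrite ltW// fpos// hypot_ge0.
  - move=> x /= ; rewrite in_itv/= => /andP[xx xb] _.
    have [h1 h2] := hb _ xx xb; have xp := xpos _ xx.
    rewrite fctE/= derive1_hypot// -EFinM lee_fin mulrCA ler_peMr//.
      by rewrite ltW// fpos// hypot_ge0.
    rewrite mulrA ler_pdivlMr ?hypot_gt0// mul1r; lra.
rewrite -S; apply: lee_wpmul2l; first by rewrite lee_fin.
rewrite /tail /Rintegral fineK; last first.
  exact: (integrable_fin_num _ (integrable_tail fint a0)).
apply: ge0_subset_integral => //.
- by case/integrableP : (integrable_tail fint a0).
- by move=> s /itv_tailP[as_ s1]; rewrite lee_fin ltW// fpos// (le_trans a0).
- move=> s /=; rewrite !in_itv/= => /andP[s0 s1].
  by rewrite (le_trans ax0 s0)/= (le_lt_trans s1).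
Qed.

(** The substitution is made on closed subintervals, where the integrand is
    continuous; monotone convergence gives the half-open interval, at whose
    right end f may be unbounded. *)
Lemma integral_hypot_slice_le (y a x0 x1 : R) : 0 <= a -> 1 / 2 <= x0 ->
  a <= hypot y x0 -> hypot y x1 <= 1 ->
  (\int[mu]_(x in `[x0, x1[) (f (hypot y x))%:E <= 2%:E * (tail f a)%:E)%E.
Proof.
move=> a0 x0h ax0 x11.
have T0 : (0 <= 2%:E * (tail f a)%:E)%E by rewrite lee_fin mulr_ge0// tail_ge0.
have [x10|x01] := leP x1 x0.
  by rewrite set_itv_ge ?integral_set0// bnd_simp -leNgt.
have x00 : 0 < x0 by apply: lt_le_trans x0h.
pose b n : R := x1 - (x1 - x0) / n.+1%:R.
have b0 n : x0 <= b n.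
  rewrite lerBrDl -lerBrDr ler_pdivrMr ?ltr0n// ler_peMr ?ler1n// subr_ge0.
  exact: ltW.
have b1 n : b n < x1 by rewrite ltrBlDr ltrDl divr_gt0// subr_gt0.
have cov : \bigcup_n `[x0, b n]%classic = `[x0, x1[%classic.
  apply/seteqP; split => [s [n _] /=|s /=]; rewrite !in_itv/= => /andP[s0 s1].
    by rewrite s0 (le_lt_trans s1).
  have s1' : 0 < (x1 - s) / (x1 - x0) by rewrite divr_gt0// subr_gt0.
  have [N _ /(_ N (leqnn N)) /= HN] := near_infty_natSinv_lt (PosNum s1').
  exists N => //=; rewrite in_itv/= s0/= lerBrDr addrC -lerBrDr.
  by rewrite -ler_pdivlMl ?subr_gt0// mulrC ltW.
have nd : nondecreasing_seq (fun n => `[x0, b n]%classic).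
  move=> m n mn; apply/subsetPset => s /=; rewrite !in_itv/= => /andP[-> /= sm].
  apply: le_trans sm _; rewrite /b lerD2l lerN2 ler_pM2l ?subr_gt0//.
  by rewrite lef_pV2 ?posrE ?ltr0n// ler_nat ltnS.
have h1 x : x0 <= x -> x < x1 -> hypot y x < 1.
  move=> xx xx1; apply: lt_le_trans x11; apply: ltr_hypot => //.
  by rewrite (le_trans _ xx)// ltW.
have := @ge0_nondecreasing_set_cvg_integral _ (measurableTypeR R) R _
  (EFin \o (f \o hypot y)) (@lebesgue_measure R) nd.
rewrite cov => /(_ (fun=> measurable_itv _)) H.
have {H} H : (\int[mu]_(x in `[x0, b n]) (EFin \o (f \o hypot y)) x)%E @[n --> \oo] -->
    (\int[mu]_(x in `[x0, x1[) (EFin \o (f \o hypot y)) x)%E.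
  apply: H => n.
    apply/measurable_EFinP; apply: subspace_continuous_measurable_fun => //.
    apply: continuous_in_subspaceT => s; rewrite inE/= in_itv/= => /andP[s0 s1].
    apply: continuous_comp; first exact: continuous_hypot.
    by apply: fcont; [exact: hypot_ge0|apply: h1 => //; exact: le_lt_trans (b1 n)].
  move=> s /=; rewrite in_itv/= => /andP[s0 s1].
  by rewrite lee_fin ltW// fpos ?hypot_ge0 ?h1// (le_lt_trans s1).
rewrite -(cvg_lim _ H)//; apply: lime_le; first by apply/cvg_ex; eexists; exact: H.
near=> n; apply: integral_hypot_closed_le => //.
exact: h1.
Unshelve. all: by end_near. Qed.

End slice.
End hypot_slices.

(** * Annular sectors in the plane *)

(** In a thin sector around the positive real axis, Cartesian slices serve the
    purpose of polar coordinates. *)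
Definition sector (R : realType) (eta : R) (I : interval R) : set (R * R) :=
  [set p | [/\ `|p.2| <= eta, 1 / 2 <= p.1 & hypot p.2 p.1 \in I]].

Section sectors.
Context (R : realType).
Notation mu := (@lebesgue_measure R).
Notation nu := (@lebesgue_measure R \x @lebesgue_measure R)%E.

Lemma measurable_hypot : measurable_fun setT (fun p : R * R => hypot p.2 p.1).
Proof.
apply: (measurableT_comp (continuous_measurable_fun (@sqrt_continuous R))).
by apply: measurable_funD; apply: measurable_funX;
  [exact: measurable_fst|exact: measurable_snd].
Qed.

Lemma measurable_sector (eta : R) (I : interval R) : measurable (sector eta I).
Proof.
have -> : sector eta I = (snd @^-1` `[- eta, eta]%classic) `&`
    (fst @^-1` `[1 / 2, +oo[%classic) `&`
    ((fun p : R * R => hypot p.2 p.1) @^-1` [set` I]).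
  apply/seteqP; split => [p [h1 h2 h3] /=|p /= [[h1 h2] h3]].
    by split => //; split => //; rewrite in_itv/= ?andbT// -ler_norml.
  by split => //; [move: h1; rewrite in_itv/= -ler_norml|move: h2; rewrite in_itv/= andbT].
apply: measurableI; first apply: measurableI.
- by rewrite -[X in measurable X]setTI; apply: measurable_snd.
- by rewrite -[X in measurable X]setTI; apply: measurable_fst.
- by rewrite -[X in measurable X]setTI; apply: measurable_hypot.
Qed.

(** On each line at height y the map x |-> hypot y x is 1-Lipschitz, so the
    slice of the sector has length at least beta - alpha. *)
Lemma sector_measure_ge (eta alpha beta : R) : 0 <= eta -> 1 / 2 <= alpha ->
  eta ^+ 2 + 1 / 4 <= alpha ^+ 2 -> alpha <= beta ->
  ((2 * eta * (beta - alpha))%:E <= nu (sector eta `[alpha, beta]))%E.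
Proof.
move=> eta0 a2 ea ab; set A := sector _ _.
have mA : measurable A by exact: measurable_sector.
have -> : nu A = (\int[nu]_p (\1_A p)%:E)%E by rewrite integral_indic// setIT.
rewrite fubini_tonelli2//; last first.
  exact/measurable_EFinP/measurable_indic.
have -> : (2 * eta * (beta - alpha))%:E =
    (\int[mu]_(y in `[(- eta)%R, eta]) (beta - alpha)%:E)%E.
  rewrite integral_cst// /= lebesgue_measure_itv/= lte_fin.
  case: ifPn => [_|]; first by rewrite -EFinD -EFinM; congr EFin; ring.
  rewrite -leNgt => e0; have -> : eta = 0 by lra.
  by rewrite mulr0 mul0r mule0.
rewrite -[leRHS]mul1e; apply: ge0_le_integral_restrict => //.
- by move=> y _; rewrite lee_fin subr_ge0.
- by move=> y _; apply: integral_ge0 => x _; rewrite lee_fin.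
move=> y; rewrite /= in_itv/= -ler_norml => ye _; rewrite mul1e /fubini_G.
have y2 : y ^+ 2 <= eta ^+ 2.
  by rewrite -[leLHS]real_normK ?num_real// lerXn2r// nnegrE.
pose x1 := Num.sqrt (alpha ^+ 2 - y ^+ 2); pose x2 := Num.sqrt (beta ^+ 2 - y ^+ 2).
have x1E : x1 ^+ 2 = alpha ^+ 2 - y ^+ 2 by rewrite sqr_sqrtr//; lra.
have al0 : 0 < alpha by lra.
have ab2 : alpha ^+ 2 <= beta ^+ 2 by rewrite lerXn2r ?nnegrE//; lra.
have x2E : x2 ^+ 2 = beta ^+ 2 - y ^+ 2 by rewrite sqr_sqrtr//; lra.
have x10 : 0 <= x1 by exact: sqrtr_ge0.
have x12 : x1 <= x2 by rewrite ler_wsqrtr// lerD2r.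
have y20 := sqr_ge0 y.
have x1a : x1 <= alpha.
  by rewrite -(@ler_sqr _ x1) ?nnegrE ?x1E//; lra.
have x2b : x2 <= beta.
  by rewrite -(@ler_sqr _ x2) ?nnegrE ?x2E//; lra.
have x1h : 1 / 2 <= x1.
  by rewrite -(@ler_sqr _ (1 / 2)) ?nnegrE ?x1E//; lra.
apply: (@le_trans _ _ (mu `[x1, x2]%classic)).
  rewrite lebesgue_measure_itv/= lte_fin; case: ifPn => [_|].
    rewrite -EFinD lee_fin; nra.
  rewrite -leNgt => x21; have x12E : x1 = x2 by apply/eqP; rewrite eq_le x12.
  rewrite lee_fin; nra.
have -> : mu `[x1, x2]%classic = (\int[mu]_(x in `[x1, x2]) 1%:E)%E.
  by rewrite integral_cst//= mul1e.
rewrite -[leRHS]mul1e; apply: ge0_le_integral_restrict => //.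
move=> x /=; rewrite in_itv/= => /andP[xx1 xx2] _; rewrite mul1e lee_fin.
have x0 : 0 <= x by lra.
have xs1 : x1 ^+ 2 <= x ^+ 2 by rewrite lerXn2r ?nnegrE.
have xs2 : x ^+ 2 <= x2 ^+ 2 by rewrite lerXn2r ?nnegrE//; lra.
have hs := hypot_sq x y; have h0 := hypot_ge0 x y.
rewrite indicE mem_set//; split => //=; first by lra.
rewrite in_itv/=; apply/andP; split.
  by rewrite -(@ler_sqr _ alpha) ?nnegrE ?hs//; lra.
by rewrite -(@ler_sqr _ _ beta) ?nnegrE ?hs//; lra.
Qed.

Section radial_integral.
Context (f : R -> R).
Hypotheses (fpos : forall s, 0 <= s -> s < 1 -> 0 < f s)
  (fcont : forall s, 0 <= s -> s < 1 -> {for s, continuous f})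
  (fint : mu.-integrable `[0, 1[ (EFin \o f)).

(** Tonelli, with [integral_hypot_slice_le] on each of the lines of height
    y in [-eta, eta]. *)
Lemma sector_integral_le (eta a : R) : 0 <= eta -> eta <= 1 -> 0 <= a -> a < 1 ->
  (\int[nu]_(p in sector eta `[a, 1%R[) (f (hypot p.2 p.1))%:E <=
   (4 * eta * tail f a)%:E)%E.
Proof.
move=> eta0 eta1 a0 a1; set D := sector _ _.
pose f0 := f \_ `[0, 1[%classic.
have f0ge s : 0 <= f0 s.
  rewrite /f0 patchE; case: ifPn => // /set_mem /itv_tailP[s0 s1].
  by rewrite ltW// fpos.
pose F (p : R * R) : \bar R := (\1_D p * f0 (hypot p.2 p.1))%:E.
have mF : measurable_fun setT F.
  apply/measurable_EFinP; apply: measurable_funM.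
    by apply: measurable_indic; exact: measurable_sector.
  apply: measurableT_comp; last exact: measurable_hypot.
  apply/(measurable_restrictT _ _).1 => //.
  by case/integrableP : fint => /measurable_EFinP.
have F0 p : (0 <= F p)%E by rewrite lee_fin mulr_ge0.
have T0 : 0 <= tail f a by rewrite tail_ge0.
apply: (@le_trans _ _ (\int[nu]_p F p)%E).
  rewrite -[leRHS]mul1e; apply: ge0_le_integral_restrict => //.
    move=> p [_ _]; rewrite in_itv/= => /andP[s0 s1].
    by rewrite lee_fin ltW// fpos// hypot_ge0.
  move=> p Dp _; rewrite mul1e lee_fin indicE mem_set// mul1r /f0.
  case: Dp => _ _; rewrite in_itv/= => /andP[s0 s1].
  rewrite patchE mem_set//; apply/itv_tailP; split => //; exact: hypot_ge0.
rewrite fubini_tonelli2//.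
have -> : (4 * eta * tail f a)%:E =
    ((2 * tail f a)%:E * \int[mu]_(y in `[(- eta)%R, eta]) 1%:E)%E.
  rewrite integral_cst// mul1e /= lebesgue_measure_itv/= lte_fin.
  case: ifPn => [_|]; first by rewrite -EFinD -EFinM; congr EFin; ring.
  rewrite -leNgt => e0; have -> : eta = 0 by lra.
  by rewrite mulr0 mul0r mule0.
apply: ge0_le_integral_restrict.
- by rewrite mulr_gt0// tail_gt0.
- by move=> y _; apply: integral_ge0.
- by move=> y _; rewrite lee_fin.
- move=> y _; apply: contraPP; rewrite /= in_itv/= -ler_norml => ye.
  rewrite /fubini_G integral0_eq ?ltxx// => x _; rewrite /F indicE memNset ?mul0r//.
  by case.
move=> y _; rewrite /= in_itv/= -ler_norml mule1 EFinM /fubini_G => ye.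
have y2 : y ^+ 2 <= 1.
  by rewrite -[leLHS]real_normK ?num_real// expr_le1//; exact: le_trans eta1.
pose x0 := Num.max (1 / 2) (Num.sqrt (a ^+ 2 - y ^+ 2)).
pose x1 := Num.sqrt (1 - y ^+ 2).
have x0h : 1 / 2 <= x0 by rewrite le_max lexx.
have ax0 : a <= hypot y x0.
  rewrite -(@ler_sqr _ a) ?nnegrE ?hypot_ge0// hypot_sq -lerBlDr.
  have [ay|ay] := leP 0 (a ^+ 2 - y ^+ 2); last by rewrite (le_trans (ltW ay))// sqr_ge0.
  rewrite -[leLHS](sqr_sqrtr ay) lerXn2r ?nnegrE ?sqrtr_ge0//.
    by rewrite (le_trans _ x0h).
  by rewrite le_max lexx orbT.
have hx1 : hypot y x1 <= 1.
  rewrite -(@ler_sqr _ _ 1) ?nnegrE ?hypot_ge0// hypot_sq sqr_sqrtr ?subr_ge0//.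
  by rewrite subrK expr1n.
apply: le_trans (integral_hypot_slice_le fpos fcont fint a0 x0h ax0 hx1).
rewrite -[leRHS]mul1e.
have inner x : D (x, y) -> x0 <= x /\ x < x1.
  move=> [_ /= xh]; rewrite in_itv/= => /andP[ah h1].
  have xp : 0 <= x by rewrite (le_trans _ xh).
  have hs := hypot_sq x y; have h0 := hypot_ge0 x y.
  have a2 : a ^+ 2 <= hypot y x ^+ 2 by rewrite lerXn2r ?nnegrE.
  have h2 : hypot y x ^+ 2 < 1 by rewrite expr_lt1.
  split.
    rewrite ge_max xh/= -(ger0_norm xp) -sqrtr_sqr ler_wsqrtr//.
    by rewrite lerBlDr -hs.
  rewrite -(ger0_norm xp) -sqrtr_sqr ltr_sqrt; first by rewrite ltrBrDr -hs.
  by rewrite subr_gt0; have := sqr_ge0 x; lra.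
apply: ge0_le_integral_restrict => //.
- move=> x /=; rewrite in_itv/= => /andP[xx0 xx1].
  rewrite lee_fin ltW// fpos ?hypot_ge0// (lt_le_trans _ hx1)// ltr_hypot//.
  by rewrite (le_trans _ xx0)// (le_trans _ x0h).
- move=> x _; apply: contraPP => nx; rewrite /F indicE memNset ?mul0r ?ltxx//.
  by move=> /inner[h1 h2]; apply: nx; rewrite /= in_itv/= h1.
- move=> x _; rewrite /= in_itv/= => /andP[xx0 xx1]; rewrite mul1e lee_fin /F indicE.
  have hlt : hypot y x < 1.
    rewrite (lt_le_trans _ hx1)// ltr_hypot//.
    by rewrite (le_trans _ xx0)// (le_trans _ x0h).
  have f00 : f0 (hypot y x) = f (hypot y x).
    by rewrite /f0 patchE mem_set//; apply/itv_tailP; split => //; exact: hypot_ge0.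
  rewrite /= f00 ler_piMl//; last by case: (_ \in _).
  by rewrite ltW// fpos// hypot_ge0.
Qed.

End radial_integral.
End sectors.

(** * Lacunary polynomials and disc automorphisms *)

Section modulus.
Context (R : realType).
Implicit Types z u : R[i].

Lemma cmodM z u : cmod (z * u) = cmod z * cmod u.
Proof. exact: ComplexField.Normc.normcM. Qed.

Lemma cmodV z : cmod z^-1 = (cmod z)^-1.
Proof. exact: ComplexField.Normc.normcV. Qed.

Lemma cmod_ge0 z : 0 <= cmod z.
Proof. by case: z => a b; exact: sqrtr_ge0. Qed.

Lemma cmod_real (x : R) : cmod x%:C = `|x|.
Proof. by rewrite /cmod /= expr0n/= addr0 sqrtr_sqr. Qed.

Lemma cmodN z : cmod (- z) = cmod z.
Proof. by case: z => a b; rewrite /cmod/= !sqrrN. Qed.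

Lemma le_cmodD z u : cmod (z + u) <= cmod z + cmod u.
Proof. exact: le_normcD. Qed.

Lemma cmodX z n : cmod (z ^+ n) = cmod z ^+ n.
Proof.
elim: n => [|n IH]; last by rewrite !exprS cmodM IH.
by rewrite !expr0 (cmod_real 1) normr1.
Qed.

Lemma cmod_nat n : cmod (n%:R : R[i]) = n%:R.
Proof. by rewrite -(rmorph_nat (real_complex R)) cmod_real ger0_norm. Qed.

Lemma le_cmod_sum (I : Type) (s : seq I) (P : pred I) (F : I -> R[i]) :
  cmod (\sum_(i <- s | P i) F i) <= \sum_(i <- s | P i) cmod (F i).
Proof.
elim/big_ind2 : _ => [|x1 x2 y1 y2 h1 h2|//].
  by rewrite (cmod_real 0) normr0.
by apply: le_trans (le_cmodD _ _) _; exact: lerD.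
Qed.

Lemma cmod_sq z : cmod z ^+ 2 = complex.Re z ^+ 2 + complex.Im z ^+ 2.
Proof. by case: z => a b; rewrite /cmod/= sqr_sqrtr// addr_ge0// sqr_ge0. Qed.

End modulus.

Definition lacunary (R : realType) (c : nat -> R) (m : nat -> nat) (N : nat)
  (z : R[i]) : R[i] := \sum_(k < N) (c k)%:C * z ^+ m k.

Definition lacunary_deriv (R : realType) (c : nat -> R) (m : nat -> nat)
  (N : nat) (z : R[i]) : R[i] := \sum_(k < N) (c k)%:C * (m k)%:R * z ^+ (m k).-1.

Section lacunary_polynomials.
Context (R : realType) (c : nat -> R) (m : nat -> nat) (N : nat).

Lemma is_derive_lacunary_comp (phi : R[i]^o -> R[i]^o) (z d : R[i]^o) :
  is_derive z 1 phi d ->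
  is_derive z 1 ((lacunary c m N \o phi) : R[i]^o -> R[i]^o)
    (lacunary_deriv c m N (phi z) * d).
Proof.
move=> H.
have -> : (lacunary c m N \o phi : R[i]^o -> R[i]^o) =
    \sum_(k < N) (((c k)%:C : R[i]) \*: (phi ^+ m k)).
  apply/funext => x; rewrite fct_sumE /lacunary /=; apply: eq_bigr => k _.
  by rewrite exprfctE.
rewrite /lacunary_deriv mulr_suml; apply: is_derive_sum => k.
apply: is_derive_eq.
by rewrite /GRing.scale/= !mulrA.
Qed.

Lemma cmod_lacunary_deriv_le z : (forall k, 0 <= c k) ->
  cmod (lacunary_deriv c m N z) <=
  \sum_(k < N) c k * (m k)%:R * cmod z ^+ (m k).-1.
Proof.
move=> c0; apply: le_trans (le_cmod_sum _ _ _) _; apply: ler_sum => k _.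
by rewrite !cmodM cmod_real cmod_nat cmodX ger0_norm.
Qed.

Lemma cmod_lacunary_deriv_ge z n : (forall k, 0 <= c k) -> (n < N)%N ->
  c n * (m n)%:R * cmod z ^+ (m n).-1 -
  \sum_(k < N | k != n :> nat) c k * (m k)%:R * cmod z ^+ (m k).-1 <=
  cmod (lacunary_deriv c m N z).
Proof.
move=> c0 nN; rewrite /lacunary_deriv [X in _ <= cmod X](bigD1 (Ordinal nN))//=.
set A := (X in cmod (X + _)); set B := (X in cmod (_ + X)).
have AE : cmod A = c n * (m n)%:R * cmod z ^+ (m n).-1.
  by rewrite /A !cmodM cmod_real cmod_nat cmodX ger0_norm.
have : cmod A <= cmod (A + B) + cmod B.
  by rewrite -{1}(addrK B A) -(cmodN B); exact: le_cmodD.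
have : cmod B <= \sum_(k < N | k != n :> nat) c k * (m k)%:R * cmod z ^+ (m k).-1.
  apply: le_trans (le_cmod_sum _ _ _) _; apply: ler_sum => k _.
  by rewrite !cmodM cmod_real cmod_nat cmodX ger0_norm.
rewrite AE; lra.
Qed.

End lacunary_polynomials.

Definition mobius (R : realType) (a : R) (z : R[i]) : R[i] :=
  (a%:C - z) / (1 - a%:C * z).

Section mobius_theory.
Context (R : realType) (a : R).
Hypotheses (a0 : 0 < a) (a1 : a < 1).

Lemma mobius_den_neq0 z : disc z -> 1 - a%:C * z != 0.
Proof.
move=> zd; apply/eqP => /(congr1 (fun u => cmod (1 - u))).
rewrite subKr subr0 (cmod_real 1) normr1 cmodM cmod_real gtr0_norm// => E.
have z1 : cmod z < 1 := zd.
by have := ler_wpM2l (ltW a0) (ltW z1); rewrite E mulr1 leNgt a1.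
Qed.

(** The identity behind the Schwarz-Pick equality. *)
Lemma mobius_den_sq z :
  cmod (1 - a%:C * z) ^+ 2 = cmod (a%:C - z) ^+ 2 + (1 - a ^+ 2) * (1 - cmod z ^+ 2).
Proof. by rewrite !cmod_sq; case: z => x y /=; ring. Qed.

(** Hence |mobius' z| / (1 - |mobius z|^2) = 1 / (1 - |z|^2): the invariance
    that is used to transport lower bounds for derivatives. *)
Lemma one_sub_cmod_mobius z : disc z ->
  1 - cmod (mobius a z) ^+ 2 =
  (1 - a ^+ 2) * (1 - cmod z ^+ 2) / cmod (1 - a%:C * z) ^+ 2.
Proof.
move=> zd; have d0 : cmod (1 - a%:C * z) != 0.
  by apply: contra (mobius_den_neq0 zd) => /eqP/ComplexField.Normc.eq0_normc ->.
rewrite /mobius cmodM cmodV exprMn exprVn.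
have := mobius_den_sq z; set D := cmod (1 - _) in d0 *; set E := cmod (_ - z) => H.
have -> : (1 - a ^+ 2) * (1 - cmod z ^+ 2) = D ^+ 2 - E ^+ 2 by rewrite H; ring.
by rewrite mulrBl divff// expf_neq0.
Qed.

Lemma mobius_disc z : disc z -> disc (mobius a z).
Proof.
move=> zd; have := one_sub_cmod_mobius zd.
have a2 : 0 < 1 - a ^+ 2 by rewrite subr_gt0 expr_lt1// ltW.
have z2 : 0 < 1 - cmod z ^+ 2 by rewrite subr_gt0 expr_lt1// cmod_ge0.
have d0 : 0 < cmod (1 - a%:C * z) ^+ 2.
  by rewrite mobius_den_sq ltr_wpDl ?sqr_ge0// mulr_gt0.
have : 0 < (1 - a ^+ 2) * (1 - cmod z ^+ 2) / cmod (1 - a%:C * z) ^+ 2.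
  by rewrite divr_gt0// mulr_gt0.
by move=> ++ => /[swap] <-; rewrite subr_gt0 expr_lt1// cmod_ge0.
Qed.

Lemma mobiusK z : disc z -> mobius a (mobius a z) = z.
Proof.
move=> zd; have d0 := mobius_den_neq0 zd.
have a2 : 1 - a%:C ^+ 2 != 0.
  rewrite -rmorphXn -(rmorph1 (real_complex R)) -rmorphB/= fmorph_eq0.
  by rewrite gt_eqF// subr_gt0 expr_lt1// ltW.
have e2 : 1 - a%:C * mobius a z = (1 - a%:C ^+ 2) / (1 - a%:C * z).
  by rewrite /mobius; field.
by rewrite {1}/mobius e2 /mobius; field; rewrite d0 a2.
Qed.

Lemma mobius_is_disc_mobius : disc_mobius (mobius a).
Proof.
split.
  exists (-1), a%:C, (- a%:C), 1; split.
  - have -> : -1 * 1 - a%:C * - a%:C = (a ^+ 2 - 1)%:C.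
      by rewrite rmorphB rmorphXn rmorph1; ring.
    by rewrite fmorph_eq0 subr_eq0 lt_eqF// expr_lt1// ltW.
  - by move=> z /mobius_den_neq0; rewrite mulNr addrC.
  - by move=> z _; rewrite /mobius mulN1r mulNr addrC [_ + 1]addrC.
apply/seteqP; split => [_ [z zd <-]|z zd]; first exact: mobius_disc.
by exists (mobius a z); [exact: mobius_disc|exact: mobiusK].
Qed.

Lemma is_derive_mobius (z : R[i]^o) : disc z ->
  is_derive z 1 (mobius a : R[i]^o -> R[i]^o)
    (- (1 - a%:C ^+ 2) / (1 - a%:C * z) ^+ 2).
Proof.
move=> zd; have d0 := mobius_den_neq0 zd.
pose den : R[i]^o -> R[i]^o := cst 1 - a%:C \*: id.
have Hden : is_derive z 1 den (- a%:C).
  by apply: is_derive_eq; rewrite sub0r [_ *: _]mulr1.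
have dz : den z = 1 - a%:C * z by [].
have Hinv : is_derive z 1 (fun y : R[i]^o => (den y)^-1 : R[i]^o)
    (- (den z) ^- 2 *: - a%:C).
  have dn0 : den z != 0 by rewrite dz.
  by apply: DeriveDef; [exact: derivableV|rewrite deriveV// derive_val].
have Hnum : is_derive z 1 (cst a%:C - id : R[i]^o -> R[i]^o) (- 1).
  by apply: is_derive_eq; rewrite sub0r.
have -> : (mobius a : R[i]^o -> R[i]^o) =
    (cst a%:C - id) * (fun y : R[i]^o => (den y)^-1 : R[i]^o).
  by apply/funext.
apply: is_derive_eq; rewrite /= dz /GRing.scale/=.
by rewrite !fctE/=; field.
Qed.

Lemma cmod_mobius_deriv z :
  cmod (- (1 - a%:C ^+ 2) / (1 - a%:C * z) ^+ 2) =
  (1 - a ^+ 2) / cmod (1 - a%:C * z) ^+ 2.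
Proof.
rewrite cmodM cmodN cmodV cmodX; congr (_ / _).
have -> : 1 - a%:C ^+ 2 = (1 - a ^+ 2)%:C by rewrite rmorphB rmorphXn rmorph1.
by rewrite cmod_real ger0_norm// subr_ge0 expr_le1// ltW.
Qed.

End mobius_theory.

(** * Carleson squares and sectors *)

(** Mean value theorem. *)
Lemma norm_le_of_derive_le1 (R : realType) (f df : R -> R) (x : R) :
  (forall t, is_derive t (1 : R) f (df t)) -> (forall t, `|df t| <= 1) ->
  f 0 = 0 -> `|f x| <= `|x|.
Proof.
move=> Hf Hdf f0.
have cf : continuous f.
  by move=> t; apply/differentiable_continuous/derivable1_diffP; case: (Hf t).
have [x0|x0] := leP 0 x.
  have [c _] := MVT_segment x0 (fun t _ => Hf t) (continuous_subspaceT cf).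
  by rewrite f0 !subr0 => ->; rewrite normrM ler_piMl.
have [c _] := MVT_segment (ltW x0) (fun t _ => Hf t) (continuous_subspaceT cf).
rewrite f0 !sub0r => /(congr1 (fun u => `|u|)); rewrite normrM !normrN => ->.
by rewrite ler_piMl.
Qed.

Lemma norm_sin_le (R : realType) (t : R) : `|sin t| <= `|t|.
Proof.
exact: (norm_le_of_derive_le1 t (fun s => is_derive_sin s) (@cos_max R) (@sin0 R)).
Qed.

Lemma norm_atan_le (R : realType) (u : R) : `|atan u| <= `|u|.
Proof.
apply: (norm_le_of_derive_le1 u (fun s => is_derive1_atan s)); last exact: atan0.
move=> t; have t0 : 1 <= 1 + t ^+ 2 by rewrite lerDl sqr_ge0.
by rewrite ger0_norm ?invr_ge0 ?(le_trans _ t0)// invf_le1// (lt_le_trans _ t0).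
Qed.

Local Notation centered_square d := (carleson_square true false (- (d / 2)) (d / 2)).

(** The arc of length d around 1 lies above real parts close to 1, and
    |sin t| <= |t| bounds the height. *)
Lemma carleson_sub_sector (R : realType) (d : R) : 0 < d -> d <= 1 / 4 ->
  @planar R @^-1` centered_square d `<=` sector (d / 2) `[1 - d, 1[.
Proof.
move=> d0 d4 [x y] /= [r [t [r0 rd r1 tI]]]; rewrite /planar/= => -[].
rewrite !mul0r subr0 addr0 => -> ->.
have {}rd : 1 - d <= r by move: rd; lra.
have d2 : d <= 2 by lra.
have td : `|t| <= d / 2 by move: tI; rewrite in_itv/= -ler_norml.
have sd := le_trans (norm_sin_le t) td.
have cs := cos2Dsin2 t.
have h : hypot (r * sin t) (r * cos t) = r.
  by rewrite /hypot !exprMn -mulrDr cs mulr1 sqrtr_sqr ger0_norm.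
have s1 : sin t ^+ 2 <= (d / 2) ^+ 2.
  by rewrite -[leLHS]real_normK ?num_real// lerXn2r// nnegrE//; lra.
have c0 : 0 <= cos t.
  apply: cos_ge0_pihalf; rewrite -ler_norml (le_trans td)//.
  by rewrite ler_pM2r ?invr_gt0// (le_trans d2 (pi_ge2 R)).
have c34 : 3 / 4 <= cos t.
  rewrite -(@ler_sqr _ (3 / 4)) ?nnegrE//.
  have : (d / 2) ^+ 2 <= (1 / 8) ^+ 2 by rewrite lerXn2r// ?nnegrE; lra.
  lra.
split => /=.
- by rewrite normrM ger0_norm// (le_trans (ler_wpM2r _ (ltW r1)))// mul1r.
- nra.
- by rewrite h in_itv/= rd.
Qed.

(** The argument of x + iy is atan (y / x), at most |y| / x <= 2 |y| in
    absolute value. *)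
Lemma sector_sub_carleson (R : realType) (d alpha beta : R) :
  0 < d -> d <= 1 / 4 -> 1 - d <= alpha -> beta < 1 ->
  sector (d / 4) `[alpha, beta] `<=` @planar R @^-1` centered_square d.
Proof.
move=> d0 d4 ad b1 [x y] /= [/= yd x2]; rewrite in_itv/= => /andP[ah hb].
exists (hypot y x), (atan (y / x)).
have x0 : 0 < x by lra.
have h0 := hypot_gt0 y x0.
have hE : hypot y x = x * Num.sqrt (1 + (y / x) ^+ 2).
  rewrite -[X in X * _](ger0_norm (ltW x0)) -sqrtr_sqr -sqrtrM ?sqr_ge0//.
  by congr Num.sqrt; field; rewrite gt_eqF.
have q0 : 0 < Num.sqrt (1 + (y / x) ^+ 2).
  by rewrite sqrtr_gt0 ltr_wpDr ?sqr_ge0.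
have ca := cos_atan (y / x).
have c0 : cos (atan (y / x)) != 0 by rewrite ca invr_neq0// gt_eqF.
have sa : sin (atan (y / x)) = y / x * cos (atan (y / x)).
  by rewrite -{2}(atanK (y / x)) /tan divfK.
split.
- exact: ltW.
- lra.
- exact: le_lt_trans hb b1.
- rewrite in_itv/= -ler_norml (le_trans (norm_atan_le _))// normrM normfV.
  rewrite (gtr0_norm x0) ler_pdivrMr// (le_trans yd)//; nra.
- rewrite sa ca /planar/=; congr (_ +i* _); rewrite hE !(mul0r, subr0, addr0).
    by field; rewrite gt_eqF.
  by field; rewrite !gt_eqF.
Qed.

(** The quotient by 0 is +oo, so the case B = 0 causes no harm. *)
Lemma lee_ratio (R : realType) (A B : \bar R) (t b : R) : 0 < t -> 0 < b ->
  (0 <= B)%E -> (B <= b%:E)%E -> ((t * b)%:E <= A)%E -> (t%:E <= A / B)%E.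
Proof.
move=> t0 b0; case: B => [B||]//; rewrite !lee_fin => B0 Bb tA.
have A0 : (0 < A)%E by apply: lt_le_trans tA; rewrite lte_fin mulr_gt0.
have [->|Bn0] := eqVneq B 0; first by rewrite inve0 gt0_muley// leey.
have {B0} B0 : 0 < B by rewrite lt_neqAle eq_sym Bn0.
rewrite inver (negbTE Bn0) lee_pdivlMr// (le_trans _ tA)// -EFinM lee_fin.
by rewrite ler_pM2l.
Qed.

Lemma ratio_lee (R : realType) (A B : \bar R) (M : R) : 0 <= M ->
  (0 <= A)%E -> (0 <= B)%E -> (A <= M%:E * B)%E -> (A / B <= M%:E)%E.
Proof.
move=> M0 A0; case: B => [B||]//.
  rewrite lee_fin; have [->|Bn0] := eqVneq B 0.
    rewrite mule0 => _ Ale; have -> : A = 0%E by apply/eqP; rewrite eq_le Ale.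
    by rewrite mul0e lee_fin.
  move=> B0 AB; have {B0} B0 : 0 < B by rewrite lt_neqAle eq_sym Bn0.
  by rewrite inver (negbTE Bn0) lee_pdivrMr.
by rewrite invey mule0 lee_fin.
Qed.

(** * Moebius images of sectors, and regularity of the weight *)

(** The quantity bounded is |1 - (1 - d) z|^2 for z = x + iy. Its real part
    1 - (1 - d) x lies between d and 73/64 d, since
    1 - x <= 1 - x^2 = (1 - r^2) + y^2 <= d / 8 + d^2 / 16. *)
Lemma pole_distance_bounds (R : realType) (d r x y : R) :
  0 < d -> d <= 1 / 4 -> 0 <= r -> r <= 1 -> 1 - r <= d / 16 -> 1 / 2 <= x ->
  r ^+ 2 = x ^+ 2 + y ^+ 2 -> y ^+ 2 <= (d / 4) ^+ 2 ->
  d ^+ 2 <= (1 - (1 - d) * x) ^+ 2 + ((1 - d) * y) ^+ 2 <= 2 * d ^+ 2.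
Proof.
move=> d0 d4 r0 r1 rd xh rE y2; have y20 := sqr_ge0 y.
have x1 : x <= 1 by nra.
have q0 : d <= 1 - (1 - d) * x by nra.
have q1 : 1 - (1 - d) * x <= (73 / 64) * d by nra.
have q2 : d ^+ 2 <= (1 - (1 - d) * x) ^+ 2.
  by rewrite lerXn2r// nnegrE; lra.
have q3 : (1 - (1 - d) * x) ^+ 2 <= ((73 / 64) * d) ^+ 2.
  by rewrite lerXn2r// nnegrE; lra.
have y30 : 0 <= ((1 - d) * y) ^+ 2 by exact: sqr_ge0.
have y3 : ((1 - d) * y) ^+ 2 <= y ^+ 2.
  by rewrite exprMn ler_piMl// expr_le1//; lra.
have d2 := sqr_ge0 d.
by apply/andP; split; clear -q2 q3 y30 y3 y2 d2; lra.
Qed.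

(** Here u stands for 1 - |phi z|^2, and the last hypothesis is the
    Schwarz-Pick identity; the factors 1 - (1 - d)^2 and 1 - r^2 are d and 1 - r up to a factor 2. *)
Lemma image_distance_bounds (R : realType) (d r t u D : R) :
  0 < d -> d <= 1 -> 0 <= r -> r <= 1 -> 0 <= t ->
  t / 16 <= 1 - r -> 1 - r <= t / 8 ->
  d ^+ 2 <= D -> D <= 2 * d ^+ 2 -> 0 <= u ->
  u * D = (1 - (1 - d) ^+ 2) * (1 - r ^+ 2) ->
  t / 16 <= 2 * d * u /\ d * u <= t / 2.
Proof.
move=> d0 d1 r0 r1 t0 tr rt D1 D2 u0 E.
have sd := sqr_ge0 d; have sr := sqr_ge0 (1 - r).
have d2d : d ^+ 2 <= d by rewrite expr2 ler_piMr// ltW.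
have r2r : r ^+ 2 <= r by rewrite expr2 ler_piMr.
have A1 : d * (t / 16) <= u * D.
  by rewrite E; apply: ler_pM; clear -d0 t0 tr d2d r2r; lra.
have A2 : u * D <= 2 * d * (2 * (t / 8)).
  by rewrite E; apply: ler_pM; clear -d0 t0 r1 rt d2d r2r sd sr; lra.
split; rewrite -(ler_pM2l d0).
  apply: (le_trans A1).
  have -> : d * (2 * d * u) = u * (2 * d ^+ 2) by ring.
  by rewrite ler_wpM2l.
apply: (@le_trans _ _ (u * D)); last by clear -A2; lra.
have -> : d * (d * u) = u * d ^+ 2 by ring.
by rewrite ler_wpM2l.
Qed.

(** With D = |1 - a z|^2 one has 1 - |phi z|^2 = (1 - a^2)(1 - |z|^2) / D;
    in the sector D lies between d^2 and 2 d^2, so that 1 - |phi z| is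
    comparable to (1 - |z|) / d. *)
Lemma mobius_annulus (R : realType) (d mu : R) (p : R * R) :
  0 < d -> d <= 1 / 4 -> 2 <= mu ->
  p \in sector (d / 4) `[1 - d / (8 * mu), 1 - d / (16 * mu)] ->
  1 / 64 <= mu * (1 - cmod (mobius (1 - d) (planar p))) /\
  mu * (1 - cmod (mobius (1 - d) (planar p))) <= 1 / 2.
Proof.
move=> d0 d4 mu2; rewrite inE.
set z := planar p; set rho := cmod (mobius (1 - d) z).
case; set y := p.2; set x := p.1; set r := hypot y x => yd xh.
rewrite in_itv/= => /andP[rl ru]; pose t := d / mu.
have mu0 : 0 < mu by lra.
have t0 : 0 < t by rewrite divr_gt0.
have mt : mu * t = d by rewrite /t mulrC divfK// gt_eqF.
have td : 2 * t <= d by rewrite -mt; nra.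
have {}rl : 1 - r <= t / 8.
  move: rl; rewrite (_ : d / (8 * mu) = t / 8); first by lra.
  by rewrite /t; field; rewrite gt_eqF.
have {}ru : t / 16 <= 1 - r.
  move: ru; rewrite (_ : d / (16 * mu) = t / 16); first by lra.
  by rewrite /t; field; rewrite gt_eqF.
have r0 : 0 <= r := hypot_ge0 x y.
have rE : r ^+ 2 = x ^+ 2 + y ^+ 2 := hypot_sq x y.
have cz : cmod z = r by [].
have r1 : r < 1 by lra.
have zd : disc z by rewrite -cz in r1.
have a0 : 0 < 1 - d by lra.
have a1 : 1 - d < 1 by lra.
have rho0 : 0 <= rho := cmod_ge0 _.
have rho1 : rho < 1 := mobius_disc a0 a1 zd.
have y2 : y ^+ 2 <= (d / 4) ^+ 2.
  by rewrite -[leLHS]real_normK ?num_real// lerXn2r// nnegrE//; lra.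
have rd : 1 - r <= d / 16 by lra.
have := one_sub_cmod_mobius a0 a1 zd; rewrite cz -/rho.
set D := cmod (1 - _) ^+ 2.
have /andP[D1 D2] : d ^+ 2 <= D <= 2 * d ^+ 2.
  have -> : D = (1 - (1 - d) * x) ^+ 2 + ((1 - d) * y) ^+ 2.
    by rewrite /D cmod_sq /z /planar/=; ring.
  exact: (pole_distance_bounds d0 d4 r0 (ltW r1) rd xh rE y2).
have D0 : 0 < D by rewrite (lt_le_trans _ D1)// exprn_gt0.
move=> E.
have {}E : (1 - rho ^+ 2) * D = (1 - (1 - d) ^+ 2) * (1 - r ^+ 2).
  by rewrite E divfK// gt_eqF.
have u0 : 0 <= 1 - rho ^+ 2 by rewrite subr_ge0 expr_le1// ltW.
have d1 : d <= 1 by lra.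
have [B1 B2] := image_distance_bounds d0 d1 r0 (ltW r1) (ltW t0) ru rl D1 D2 u0 E.
have C1 : 1 / 32 <= mu * (1 - rho ^+ 2).
  rewrite -(ler_pM2l d0); have := ler_wpM2l (ltW mu0) B1.
  by rewrite [leLHS]mulrA mt; clear; lra.
have C2 : mu * (1 - rho ^+ 2) <= 1 / 2.
  rewrite -(ler_pM2l d0); have := ler_wpM2l (ltW mu0) B2.
  by rewrite [leRHS]mulrA mt; clear; lra.
have v2 : rho ^+ 2 <= rho by rewrite expr2 ler_piMr// ltW.
have v1 : 1 - rho ^+ 2 <= 2 * (1 - rho).
  by have := sqr_ge0 (1 - rho); clear; lra.
split.
  by move: (ler_wpM2l (ltW mu0) v1) C1; clear; lra.
by apply: le_trans (ler_wpM2l (ltW mu0) _) C2; rewrite lerD2l lerN2.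
Qed.

(** The last factor is |mobius' z|; it equals
    (1 - |mobius z|^2) / (1 - |z|^2) by [one_sub_cmod_mobius]. *)
Lemma cmod_mobius_deriv_ge (R : realType) (a G c : R) (z : R[i]) :
  0 < a -> a < 1 -> disc z -> 0 <= G -> c <= G * (1 - cmod (mobius a z)) ->
  c / (2 * (1 - cmod z)) <= G * ((1 - a ^+ 2) / cmod (1 - a%:C * z) ^+ 2).
Proof.
move=> a0 a1 zd G0 Gc.
have z1 : cmod z < 1 := zd; have z0 := cmod_ge0 z.
have x0 : 0 < 1 - cmod z by rewrite subr_gt0.
have u0 : 0 < 1 - cmod z ^+ 2 by nra.
have D0 : cmod (1 - a%:C * z) != 0.
  apply: contra (mobius_den_neq0 a0 a1 zd).
  by move/eqP/ComplexField.Normc.eq0_normc ->.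
have -> : (1 - a ^+ 2) / cmod (1 - a%:C * z) ^+ 2 =
    (1 - cmod (mobius a z) ^+ 2) / (1 - cmod z ^+ 2).
  by rewrite one_sub_cmod_mobius//; field; rewrite D0 gt_eqF.
have := cmod_ge0 (mobius a z); have : cmod (mobius a z) < 1 := mobius_disc a0 a1 zd.
set rho := cmod (mobius a z) in Gc *; move=> rho1 rho0.
rewrite mulrA ler_pdivrMr; last by lra.
rewrite mulrAC ler_pdivlMr//.
apply: (@le_trans _ _ (G * (1 - rho) * (1 - cmod z ^+ 2))).
  by rewrite ler_pM2r.
have -> : 1 - cmod z ^+ 2 = (1 - cmod z) * (1 + cmod z) by ring.
rewrite -!mulrA; apply: ler_wpM2l => //.
have -> : (1 - rho ^+ 2) * (2 * (1 - cmod z)) = (1 - rho) * ((1 + rho) * 2 * (1 - cmod z)).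
  by ring.
apply: ler_wpM2l; first by rewrite subr_ge0 ltW.
rewrite mulrC; apply: ler_wpM2r; first exact: ltW.
lra.
Qed.

Lemma continuous_profile (R : realType) (w : R[i] -> R) (s : R) :
  {for s%:C, continuous (w : R[i]^o -> R)} -> {for s, continuous (fun t : R => w t%:C)}.
Proof.
move=> cw; apply: (@continuous_comp _ _ _ (fun t : R => (t%:C : R[i]^o)) w) => //.
apply/cvgrPdist_lt => -[er ei]; rewrite ltcE/= => /andP[/eqP -> er0].
near=> t; rewrite -rmorphB normc_def/= expr0n/= addr0 sqrtr_sqr ltcE/= eqxx/=. 
by near: t; exists er.
Unshelve. all: by end_near. Qed.

(** The factor s in the integrals lies between a and 1. *)
Lemma tail_doubling (R : realType) (f : R -> R) (C a : R)
  (fpos : forall s, 0 <= s -> s < 1 -> 0 < f s)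
  (fint : (@lebesgue_measure R).-integrable `[0, 1[ (EFin \o f)) :
  0 < C -> 0 < a -> a < 1 ->
  \int[@lebesgue_measure R]_(s in `[a, 1[) (f s * s) <=
    C * \int[@lebesgue_measure R]_(s in `[2 * a / (1 + a ^+ 2), 1[) (f s * s) ->
  a * tail f a <= C * tail f (2 * a / (1 + a ^+ 2)).
Proof.
move=> C0 a0 a1 H.
have I b : 0 <= b -> (@lebesgue_measure R).-integrable `[b, 1[ (EFin \o (fun s => f s * s)).
  move=> b0; have fb := integrable_tail fint b0.
  apply: (le_integrable _ _ _ fb) => //.
    apply/measurable_EFinP; apply: measurable_funM; last exact: measurable_id.
    by case/integrableP : fb => /measurable_EFinP.
  move=> s /itv_tailP[bs s1] /=; have s0 := le_trans b0 bs.
  by rewrite lee_fin normrM ler_piMr// ger0_norm// ltW.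
have b0 : 0 <= 2 * a / (1 + a ^+ 2).
  by rewrite divr_ge0 ?mulr_ge0 ?(ltW a0)// addr_ge0// sqr_ge0.
apply: (@le_trans _ _ (\int[@lebesgue_measure R]_(s in `[a, 1[) (f s * s))).
  rewrite /tail -RintegralZl//; last exact: (integrable_tail fint (ltW a0)).
  apply: le_Rintegral => //.
  - exact: (integrableZl _ a (integrable_tail fint (ltW a0))).
  - exact: I (ltW a0).
  - move=> s /itv_tailP[as_ s1].
    by rewrite mulrC ler_wpM2l// ltW// fpos// (le_trans (ltW a0)).
apply: (le_trans H); apply: ler_wpM2l; first exact: ltW.
apply: le_Rintegral => //.
- exact: I.
- exact: (integrable_tail fint b0).
- move=> s /itv_tailP[bs s1]; have s0 := le_trans b0 bs.
  by rewrite ler_piMr// ltW// fpos.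
Qed.

(** * Uniform bound for the seminorms of lacunary polynomials *)

Lemma wstar0 (R : realType) (w : R[i] -> R) : wstar w 0 = 0.
Proof.
rewrite /wstar (cmod_real 0) normr0.
transitivity (\int[@lebesgue_measure R]_(s in `[0, 1[) (0 : R)).
  by apply: eq_Rintegral => s _; rewrite invr0 mulr0 ln0// mulr0 mul0r.
by rewrite Rintegral_cst// mul0r.
Qed.

Lemma carleson_square_disc (R : realType) p q (a b : R) :
  carleson_square p q a b `<=` @disc R.
Proof.
move=> z [r [t [r0 _ r1 _ ->]]]; rewrite /disc /mkset cmodM cmod_real ger0_norm//.
by rewrite /cmod /ComplexField.Normc.normc cos2Dsin2 sqrtr1 mulr1.
Qed.

Section lacunary_seminorms.
Context (R : realType) (w : R[i] -> R) (K : R) (p : nat).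
Let f (s : R) : R := w s%:C.
Hypotheses (wpos : forall z, disc z -> 0 < w z) (wrad : radial w)
  (fcont : forall s, 0 <= s -> s < 1 -> {for s, continuous f})
  (fint : (@lebesgue_measure R).-integrable `[0, 1[ (EFin \o f))
  (K0 : 0 < K) (e1 : almost_decreasing K (decay f))
  (e2 : almost_linear_decay K (decay f)) (p2 : (2 <= p)%N).

Let c := lacunary_coef (decay f) p.
Let m := gap_exp p.

Let fpos (s : R) : 0 <= s -> s < 1 -> 0 < f s.
Proof. by move=> s0 s1; apply: wpos; rewrite /disc /mkset cmod_real ger0_norm. Qed.

Let epos := decay_gt0 fpos fcont fint.

Let c_gt0 k : 0 < c k.
Proof. exact: lacunary_coef_gt0. Qed.

Let c_ge0 k : 0 <= c k. Proof. exact/ltW/c_gt0. Qed.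

Lemma wstar_ge0 z : disc z -> 0 <= wstar w z.
Proof.
move=> zd; have z1 : cmod z < 1 := zd.
have [z0|z0] := ltP 0 (cmod z); last first.
  suff -> : z = 0 by rewrite wstar0.
  by apply: ComplexField.Normc.eq0_normc; apply/eqP; rewrite eq_le z0 cmod_ge0.
apply: Rintegral_ge0 => s /itv_tailP[zs s1].
have s0 := lt_le_trans z0 zs.
rewrite mulr_ge0 ?(ltW s0)// mulr_ge0 ?(ltW (fpos _ _))// ?(ltW s0)//.
by rewrite ln_ge0// ler_pdivlMr// mul1r.
Qed.

(** The lacunary sum is at most const |z| sqrt (e |z|) / (1 - |z|); squaring
    and multiplying by wstar z <= (1 - |z|) / |z| W(|z|) leaves
    const |z| w z. The factor |z|^2 coming from the derivative absorbs the
    singularity of wstar at 0. *)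
Lemma weighted_lacunary_deriv_le N z : disc z ->
  cmod (lacunary_deriv c m N z) ^+ 2 * wstar w z <= 20 ^+ 2 * K * w z.
Proof.
move=> zd; have z1 : cmod z < 1 := zd; have wz := wpos zd.
have K4 : 0 < 20 ^+ 2 * K by rewrite mulr_gt0// exprn_gt0.
have [z0|z0] := ltP 0 (cmod z); last first.
  have -> : z = 0.
    by apply: ComplexField.Normc.eq0_normc; apply/eqP; rewrite eq_le z0 cmod_ge0.
  have w0 : 0 < w 0 by apply: wpos; rewrite /disc /mkset (cmod_real 0) normr0.
  by rewrite wstar0 mulr0 (mulr_ge0 (ltW K4) (ltW w0)).
have x0 : 0 < 1 - cmod z by rewrite subr_gt0.
have S1 := lacunary_sum_le K0 epos e1 e2 p2 N (ltW z0) z1.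
set S := \sum_(_ < _) _ in S1.
have GS : cmod (lacunary_deriv c m N z) <= cmod z * S.
  apply: (le_trans (cmod_lacunary_deriv_le _ _ _ c_ge0)).
  rewrite mulr_sumr; apply: ler_sum => k _; rewrite mulrCA ler_wpM2l//.
    by rewrite mulr_ge0.
  rewrite -exprS le_eqVlt; apply/orP; left; apply/eqP; congr (_ ^+ _).
  by have := gap_exp_ge2 k p2; rewrite -/m; case: (m k) => [|[|k']]// _; rewrite subn2.
have e0 : 0 < decay f (cmod z) by exact: epos (ltW z0) z1.
set G := cmod (lacunary_deriv _ _ _ _) in GS *.
have G0 : 0 <= G by exact: cmod_ge0.
have T0 := tail_gt0 fpos fcont fint (ltW z0) z1.
have W1 : wstar w z <= (1 - cmod z) / cmod z * tail f (cmod z).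
  exact: (log_average_le fpos fint z0 z1).
have W0 := wstar_ge0 zd.
have wf : w z = f (cmod z) by rewrite wrad.
have Gx : G * (1 - cmod z) <= cmod z * (20 * (Num.sqrt K * Num.sqrt (decay f (cmod z)))).
  apply: (le_trans (ler_wpM2r (ltW x0) GS)); rewrite -mulrA.
  exact: (ler_wpM2l (ltW z0) S1).
have Gx2 : (G * (1 - cmod z)) ^+ 2 <= cmod z ^+ 2 * (20 ^+ 2 * K * decay f (cmod z)).
  have -> : cmod z ^+ 2 * (20 ^+ 2 * K * decay f (cmod z)) =
      (cmod z * (20 * (Num.sqrt K * Num.sqrt (decay f (cmod z))))) ^+ 2.
    rewrite !exprMn !sqr_sqrtr ?(ltW K0) ?(ltW e0)//; ring.
  rewrite lerXn2r// nnegrE ?mulr_ge0 ?sqrtr_ge0 ?(ltW x0) ?(ltW z0)//.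
have x20 : 0 < (1 - cmod z) ^+ 2 by rewrite exprn_gt0.
rewrite -(ler_pM2r x20).
have -> : G ^+ 2 * wstar w z * (1 - cmod z) ^+ 2 =
  (G * (1 - cmod z)) ^+ 2 * wstar w z by ring.
apply: (@le_trans _ _ (cmod z ^+ 2 * (20 ^+ 2 * K * decay f (cmod z)) *
    ((1 - cmod z) / cmod z * tail f (cmod z)))).
  by apply: ler_pM => //; exact: sqr_ge0.
have -> : cmod z ^+ 2 * (20 ^+ 2 * K * decay f (cmod z)) *
    ((1 - cmod z) / cmod z * tail f (cmod z)) =
    cmod z * (20 ^+ 2 * K * w z * (1 - cmod z) ^+ 2).
  by rewrite wf /decay; field; rewrite !gt_eqF.
apply: ler_piMl; last exact: ltW.
exact: mulr_ge0 (mulr_ge0 (ltW K4) (ltW wz)) (ltW x20).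
Qed.

Lemma cderive_lacunary_comp N (phi : R[i] -> R[i]) (z d : R[i]) :
  is_derive (z : R[i]^o) 1 (phi : R[i]^o -> R[i]^o) d ->
  cderivable (lacunary c m N \o phi) z /\
  cderive (lacunary c m N \o phi) z = lacunary_deriv c m N (phi z) * d.
Proof.
move=> H; have D := is_derive_lacunary_comp c m N H.
split; first by case: D.
by rewrite /cderive derive1E derive_val.
Qed.

Lemma cderive_lacunary N z :
  cderivable (lacunary c m N) z /\
  cderive (lacunary c m N) z = lacunary_deriv c m N z.
Proof.
have [] := @cderive_lacunary_comp N id z 1 (is_derive_id _ _).
by rewrite mulr1.
Qed.

Lemma lacunary_ratio_le N pl pr (a b : R) :
  (C1_ratio w (wstar w) (lacunary c m N) (carleson_square pl pr a b) <=
    (20 ^+ 2 * K)%:E)%E.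
Proof.
have K4 : 0 < 20 ^+ 2 * K by rewrite mulr_gt0// exprn_gt0.
have pi0 : (0 <= (pi^-1 : R)%:E)%E by rewrite lee_fin invr_ge0 pi_ge0.
have sub x : (@planar R @^-1` carleson_square pl pr a b) x -> disc (planar x).
  exact: carleson_square_disc.
apply: ratio_lee.
- exact: ltW.
- rewrite mule_ge0//; apply: integral_ge0 => x /sub xd.
  by rewrite lee_fin mulr_ge0 ?sqr_ge0// wstar_ge0.
- rewrite mule_ge0//; apply: integral_ge0 => x /sub xd.
  by rewrite lee_fin ltW// wpos.
rewrite /dA_integral muleCA; apply: lee_wpmul2l => //.
apply: ge0_le_integral_restrict => //.
- by move=> x /sub xd; rewrite lee_fin mulr_ge0 ?sqr_ge0// wstar_ge0.
- by move=> x /sub xd; rewrite lee_fin ltW// wpos.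
- move=> x /sub xd _; rewrite -EFinM lee_fin.
  by rewrite (cderive_lacunary N _).2 weighted_lacunary_deriv_le.
Qed.

Lemma lacunary_seminorm_le N :
  (C1_seminorm w (lacunary c m N) <= (Num.sqrt (20 ^+ 2 * K))%:E)%E.
Proof.
have K4 : 0 < 20 ^+ 2 * K by rewrite mulr_gt0// exprn_gt0.
have -> : (Num.sqrt (20 ^+ 2 * K))%:E = sqrte (20 ^+ 2 * K)%:E by [].
rewrite lee_sqrt ?lee_fin ?(ltW K4)//.
apply: ge_ereal_sup => _ [pl [pr [a [b [_ _ ->]]]]].
exact: lacunary_ratio_le.
Qed.

Lemma lacunary_in_C1 N : C1_space w (lacunary c m N).
Proof.
split; first by move=> z _; have [] := cderive_lacunary N z.
by apply: le_lt_trans (lacunary_seminorm_le N) _; rewrite ltry.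
Qed.

End lacunary_seminorms.

(** * Pointwise lower bound after composition with a Moebius map *)

Lemma gap_exp_mul4 p i j : (2 <= p)%N -> (i < j)%N ->
  (4 * gap_exp p i <= gap_exp p j)%N.
Proof.
move=> p2; have step k : (4 * gap_exp p k <= gap_exp p k.+1)%N.
  by rewrite gap_expS leq_mul2r (@leq_exp2r 2 p 2)// p2 orbT.
elim: j => // j IH; rewrite ltnS leq_eqVlt => /predU1P[->//|/IH H].
apply: leq_trans H _; apply: leq_trans (step j).
by rewrite leq_pmull.
Qed.

Lemma le_gap_exp p i j : (2 <= p)%N -> (i <= j)%N -> (gap_exp p i <= gap_exp p j)%N.
Proof.
move=> p2; rewrite leq_eqVlt => /predU1P[->//|/(gap_exp_mul4 p2)].
by apply: leq_trans; rewrite leq_pmull.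
Qed.

Section lacunary_mobius.
Context (R : realType) (w : R[i] -> R) (K C d : R) (p : nat).
Let f (s : R) : R := w s%:C.
Hypotheses (wpos : forall z, disc z -> 0 < w z) (wrad : radial w)
  (fcont : forall s, 0 <= s -> s < 1 -> {for s, continuous f})
  (fint : (@lebesgue_measure R).-integrable `[0, 1[ (EFin \o f))
  (K0 : 0 < K) (e1 : almost_decreasing K (decay f))
  (e2 : almost_linear_decay K (decay f)) (p2 : (2 <= p)%N)
  (pK : 320 * 256 * K <= p%:R) (C0 : 0 < C) (d0 : 0 < d) (d4 : d <= 1 / 4)
  (doubling : (1 - d) * tail f (1 - d) <=
     C * tail f (2 * (1 - d) / (1 + (1 - d) ^+ 2))).

Let c := lacunary_coef (decay f) p.
Let m := gap_exp p.

Let fpos (s : R) : 0 <= s -> s < 1 -> 0 < f s.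
Proof. by move=> s0 s1; apply: wpos; rewrite /disc /mkset cmod_real ger0_norm. Qed.

Let epos := decay_gt0 fpos fcont fint.

Let a0 : 0 < 1 - d. Proof. by move: d0 d4; lra. Qed.
Let a1 : 1 - d < 1. Proof. by move: d0; lra. Qed.
Let T0 : 0 < tail f (1 - d). Proof. exact (tail_gt0 fpos fcont fint (ltW a0) a1). Qed.

(** The n-th sector is taken by the Moebius map into the annulus in which the
    n-th term of the lacunary polynomial dominates. *)
Definition test_sector n : set (R * R) :=
  sector (d / 4) `[1 - d / (8 * (m n)%:R), 1 - d / (16 * (m n)%:R)].

Let m2 n : 2 <= (m n)%:R :> R.
Proof. by rewrite (ler_nat R 2) gap_exp_ge2. Qed.

Lemma test_sector_disjoint : trivIset setT test_sector.
Proof.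
have key i j q : (i < j)%N -> test_sector i q -> test_sector j q -> False.
  move=> ij [_ _]; rewrite in_itv/= => /andP[_ hi] [_ _].
  rewrite in_itv/= => /andP[hj _].
  have mi := m2 i; have mj := m2 j; have dd := d0.
  have mij : 4 * (m i)%:R <= (m j)%:R :> R by rewrite -natrM ler_nat gap_exp_mul4.
  have : d / (16 * (m i)%:R) <= d / (8 * (m j)%:R) by lra.
  have mi0 : 0 < (m i)%:R :> R by lra.
  have mj0 : 0 < (m j)%:R :> R by lra.
  rewrite ler_pM2l// lef_pV2 ?posrE ?mulr_gt0//; lra.
move=> i j _ _ [q [qi qj]]; have [ij|ij|//] := ltngtP i j.
  by case: (key i j q ij qi qj).
by case: (key j i q ij qj qi).
Qed.

(** The derivative is at least v / (2 (1 - |z|)) with v = c n / 256, and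
    wstar z >= (1 - |z|) / 2 W((1 + |z|) / 2). The doubling hypothesis bounds
    the last factor below by W(1 - d) / (2 C), because (1 + |z|) / 2 is at most
    the point 2 a / (1 + a^2), at distance d^2 / (1 + a^2) from 1, as soon as
    32 m_n d <= 1. *)
Lemma weighted_mobius_deriv_ge N n q : (n < N)%N -> 32 * (m n)%:R * d <= 1 ->
  test_sector n q ->
  (c n / 256) ^+ 2 * (m n)%:R * tail f (1 - d) / (2 * C * d) <=
  cmod (cderive (lacunary c m N \o mobius (1 - d)) (planar q)) ^+ 2 *
    wstar w (planar q).
Proof.
move=> nN md qn; set z := planar q; set a := 1 - d.
have [zd rl ru] : [/\ disc z, 1 - cmod z <= d / (8 * (m n)%:R) &
    d / (16 * (m n)%:R) <= 1 - cmod z].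
  have m2n := m2 n; have dd := d0.
  have q1 : 0 < d / (16 * (m n)%:R) by rewrite divr_gt0// mulr_gt0//; lra.
  have cz : cmod z = hypot q.2 q.1 by [].
  have [h1 h2] : 1 - d / (8 * (m n)%:R) <= hypot q.2 q.1 /\
      hypot q.2 q.1 <= 1 - d / (16 * (m n)%:R).
    by case: qn => _ _; rewrite in_itv/= => /andP[].
  by split; [rewrite /disc /mkset cz; lra|rewrite cz; lra|rewrite cz; lra].
have z1 : cmod z < 1 := zd.
have [A1 A2] := mobius_annulus d0 d4 (m2 n) (mem_set qn).
rewrite -/z -/a in A1 A2.
have phid := mobius_disc a0 a1 zd.
have phi1 : cmod (mobius a z) < 1 := phid.
have G1 := lacunary_dominant_term K0 epos e1 e2 p2 pK nN
  (cmod_ge0 (mobius a z)) phi1 A1 A2.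
have c0 k : 0 <= c k := ltW (lacunary_coef_gt0 epos p2 k).
have G2 := cmod_lacunary_deriv_ge m (mobius a z) c0 nN.
set G := cmod (lacunary_deriv c m N (mobius a z)) in G2.
have G3 : c n / 256 <= G * (1 - cmod (mobius a z)).
  by apply: le_trans G1 _; apply: ler_wpM2r => //; rewrite subr_ge0 ltW.
have G4 := cmod_mobius_deriv_ge a0 a1 zd (cmod_ge0 _) G3.
have dE := (cderive_lacunary_comp w p N (is_derive_mobius a0 a1 zd)).2.
rewrite dE cmodM cmod_mobius_deriv// -/G.
set H := G * _ in G4 *.
have x0 : 0 < 1 - cmod z by rewrite subr_gt0.
have cz0 : 0 < cmod z.
  have : d / (8 * (m n)%:R) < 1.
    have m2n := m2 n; have dd := d4.
    rewrite ltr_pdivrMr ?mul1r; lra.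
  by move: rl; lra.
have W := log_average_ge fpos fint cz0 z1; rewrite -/(wstar w z) in W.
have b1 : (1 + cmod z) / 2 <= 2 * a / (1 + a ^+ 2).
  have aa0 : 0 < 1 + a ^+ 2 by rewrite addr_gt0// exprn_gt0.
  have d2 : 2 * d ^+ 2 <= 1 - cmod z.
    apply: le_trans ru; rewrite ler_pdivlMr; last by move: (m2 n); lra.
    have -> : 2 * d ^+ 2 * (16 * (m n)%:R) = d * (32 * (m n)%:R * d) by ring.
    by rewrite ler_piMr// ltW.
  have -> : 2 * a / (1 + a ^+ 2) = 1 - d ^+ 2 / (1 + a ^+ 2).
    have -> : 2 * a = (1 + a ^+ 2) - d ^+ 2 by rewrite /a; ring.
    by field; rewrite gt_eqF.
  have : d ^+ 2 / (1 + a ^+ 2) <= d ^+ 2.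
    rewrite ler_pdivrMr// ler_peMr ?sqr_ge0// lerDl sqr_ge0//.
  by lra.
have b2 : 2 * a / (1 + a ^+ 2) <= 1.
  rewrite ler_pdivrMr; last by rewrite addr_gt0// exprn_gt0.
  by have := sqr_ge0 (1 - a); lra.
have W2 := le_tail fpos fint (_ : 0 <= (1 + cmod z) / 2) b1 b2.
have {}W2 : tail f (2 * a / (1 + a ^+ 2)) <= tail f ((1 + cmod z) / 2).
  by apply: W2; rewrite divr_ge0// addr_ge0// ltW.
have Ta : tail f a / (2 * C) <= tail f ((1 + cmod z) / 2).
  apply: le_trans W2; rewrite ler_pdivrMr ?mulr_gt0//.
  have := doubling; have := T0; rewrite -/a => T1 D1.
  have ah : 1 / 2 <= a by rewrite /a; move: d4; lra.
  have := ler_wpM2r (ltW T1) ah; lra.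
have W3 : (1 - cmod z) / 2 * (tail f a / (2 * C)) <= wstar w z.
  by apply: le_trans W; apply: ler_wpM2l => //; rewrite divr_ge0// ltW.
have v0 : 0 < c n / 256.
  by apply: divr_gt0; [exact: lacunary_coef_gt0|rewrite ltr0n].
have H0 : 0 <= c n / 256 / (2 * (1 - cmod z)).
  by apply: divr_ge0 (ltW v0) _; rewrite mulr_ge0// ltW.
have H2 : (c n / 256 / (2 * (1 - cmod z))) ^+ 2 <= H ^+ 2.
  by rewrite lerXn2r// nnegrE// (le_trans H0).
have TC : 0 < tail f a / (2 * C) by rewrite divr_gt0 ?mulr_gt0//; exact: T0.
apply: le_trans (ler_pM (sqr_ge0 _) _ H2 W3); last first.
  by rewrite mulr_ge0 ?(ltW TC)// divr_ge0// ltW.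
set v := c n / 256.
have -> : (v / (2 * (1 - cmod z))) ^+ 2 * ((1 - cmod z) / 2 * (tail f a / (2 * C))) =
  (v ^+ 2 * tail f a / (2 * C)) * (1 / 8 / (1 - cmod z)).
  by field; rewrite !gt_eqF.
have -> : v ^+ 2 * (m n)%:R * tail f a / (2 * C * d) =
  (v ^+ 2 * tail f a / (2 * C)) * ((m n)%:R / d).
  by field; rewrite !gt_eqF.
apply: ler_wpM2l.
  rewrite -mulrA; exact: mulr_ge0 (sqr_ge0 _) (ltW TC).
rewrite ler_pdivrMr// mulrAC ler_pdivlMr//.
have mp : 0 < (m n)%:R :> R by move: (m2 n); lra.
move: rl; rewrite ler_pdivlMr ?mulr_gt0//.
by rewrite mulrA; move=> rl; lra.
Qed.

End lacunary_mobius.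

(** * Lower bound for the ratio on a Carleson square *)

Lemma inner_radius_sq_ge (R : realType) (d t : R) :
  0 < d -> d <= 1 / 4 -> t <= d / 16 -> (d / 4) ^+ 2 + 1 / 4 <= (1 - t) ^+ 2.
Proof.
move=> d0 d4 td.
have : (15 / 16) ^+ 2 <= (1 - t) ^+ 2 by rewrite lerXn2r// ?nnegrE; lra.
have : (d / 4) ^+ 2 <= (1 / 16) ^+ 2 by rewrite lerXn2r// ?nnegrE; lra.
by clear; lra.
Qed.

Section ratio.
Context (R : realType) (w : R[i] -> R) (K C d : R) (p : nat).
Let f (s : R) : R := w s%:C.
Hypotheses (wpos : forall z, disc z -> 0 < w z) (wrad : radial w)
  (fcont : forall s, 0 <= s -> s < 1 -> {for s, continuous f})
  (fint : (@lebesgue_measure R).-integrable `[0, 1[ (EFin \o f))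
  (K0 : 0 < K) (e1 : almost_decreasing K (decay f))
  (e2 : almost_linear_decay K (decay f)) (p2 : (2 <= p)%N)
  (pK : 320 * 256 * K <= p%:R) (C0 : 0 < C) (d0 : 0 < d) (d4 : d <= 1 / 4)
  (doubling : (1 - d) * tail f (1 - d) <=
     C * tail f (2 * (1 - d) / (1 + (1 - d) ^+ 2))).

Let c := lacunary_coef (decay f) p.
Let m := gap_exp p.

Let fpos (s : R) : 0 <= s -> s < 1 -> 0 < f s.
Proof. by move=> s0 s1; apply: wpos; rewrite /disc /mkset cmod_real ger0_norm. Qed.

(** The n-th sector has area at least d^2 / (32 m_n) and carries a value of
    order c_n^2 m_n W(1 - d) / d, so it contributes a multiple of
    c_n^2 d W(1 - d), free of m_n; the weight of the whole square is at most
    2 d W(1 - d) / pi. *)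
Lemma lacunary_mobius_ratio_ge N (t : R) : 32 * (m N)%:R * d <= 1 ->
  0 < t -> t <= (\sum_(n < N) (c n / 256) ^+ 2) / (128 * C) ->
  (t%:E <= C1_ratio w (wstar w) (lacunary c m N \o mobius (1 - d))
     (centered_square d))%E.
Proof.
move=> mNd t0 tS.
have a0 : 0 < 1 - d by move: d0 d4; lra.
have a1 : 1 - d < 1 by move: d0; lra.
have T0 : 0 < tail f (1 - d) by exact (tail_gt0 fpos fcont fint (ltW a0) a1).
have pi0 : 0 < (pi : R)^-1 by rewrite invr_gt0 pi_gt0.
have dd0 := d0; have dd4 := d4; have CC := C0.
have mp n : 2 <= (m n)%:R :> R by rewrite (ler_nat R 2) gap_exp_ge2.
have Edisc q : (@planar R @^-1` centered_square d) q -> disc (planar q).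
  exact: carleson_square_disc.
have F0 q : (@planar R @^-1` centered_square d) q ->
    0 <= cmod (cderive (lacunary c m N \o mobius (1 - d)) (planar q)) ^+ 2 *
      wstar w (planar q).
  by move=> /Edisc qd; rewrite mulr_ge0 ?sqr_ge0// (wstar_ge0 wpos).
apply: (@lee_ratio _ _ _ _ (pi^-1 * (2 * d * tail f (1 - d)))) => //.
- by rewrite mulr_gt0// mulr_gt0// mulr_gt0.
- rewrite mule_ge0 ?lee_fin ?(ltW pi0)//; apply: integral_ge0 => q /Edisc qd.
  by rewrite lee_fin ltW// wpos.
- rewrite /dA_integral EFinM; apply: lee_wpmul2l; first by rewrite lee_fin ltW.
  have H := sector_integral_le fpos fcont fint
    (_ : 0 <= d / 2) (_ : d / 2 <= 1) (ltW a0) a1.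
  have -> : 2 * d * tail f (1 - d) = 4 * (d / 2) * tail f (1 - d) by field.
  apply: le_trans (H _ _); [|lra|lra].
  rewrite -[leRHS]mul1e; apply: ge0_le_integral_restrict => //.
  + by move=> q /Edisc qd; rewrite lee_fin ltW// wpos.
  + move=> q [_ _]; rewrite in_itv/= => /andP[h1 h2].
    by rewrite lee_fin ltW// fpos// hypot_ge0.
  + by move=> q qE _; exact: carleson_sub_sector qE.
  + by move=> q /Edisc qd _; rewrite mul1e lee_fin wrad.
rewrite /dA_integral mulrCA EFinM; apply: lee_wpmul2l; first by rewrite lee_fin ltW.
pose k n := (c n / 256) ^+ 2 * (m n)%:R * tail f (1 - d) / (2 * C * d).
have k0 n : 0 <= k n.
  apply: divr_ge0; last by rewrite !mulr_ge0// ltW.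
  exact: mulr_ge0 (mulr_ge0 (sqr_ge0 _) (ler0n _ _)) (ltW T0).
have S := @sum_measure_le_integral _ _ R (@lebesgue_measure R \x @lebesgue_measure R)%E
  _ _ N (test_sector d p) k F0 k0.
apply: le_trans (S _ _ _ _); first last.
- move=> n q nN qn; apply: (weighted_mobius_deriv_ge (K := K)) => //.
  apply: le_trans mNd; rewrite ler_pM2r// ler_pM2l// ler_nat.
  exact: le_gap_exp (ltnW nN).
- move=> n nN; apply: sector_sub_carleson => //.
    rewrite lerD2l lerN2 ler_pdivrMr; last by have := mp n; lra.
    by have := mp n; nra.
  by rewrite ltrBlDr ltrDl divr_gt0// mulr_gt0//; have := mp n; lra.
- exact: test_sector_disjoint.
- by move=> n; exact: measurable_sector.
- apply: (@le_trans _ _ (\sum_(n < N)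
      ((c n / 256) ^+ 2 * (tail f (1 - d) * d / (64 * C)))%:E)%E).
    rewrite sumEFin lee_fin -mulr_suml.
    apply: (le_trans (ler_wpM2r _ tS)).
      by rewrite mulr_ge0 ?mulr_ge0// ltW.
    rewrite le_eqVlt; apply/orP; left; apply/eqP; field.
    by rewrite gt_eqF.
  apply: lee_sum => n _.
  have mn0 : 0 < (m n)%:R :> R by apply: lt_le_trans (mp n).
  have q8 : d / (8 * (m n)%:R) <= d / 16.
    by rewrite ler_pM2l// lef_pV2 ?posrE ?mulr_gt0//; have := mp n; lra.
  have q1 : d / (16 * (m n)%:R) <= d / (8 * (m n)%:R).
    by rewrite ler_pM2l// lef_pV2 ?posrE ?mulr_gt0//; lra.
  have h1 : 0 <= d / 4 by lra.
  have h2 : 1 / 2 <= 1 - d / (8 * (m n)%:R) by lra.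
  have h3 : (d / 4) ^+ 2 + 1 / 4 <= (1 - d / (8 * (m n)%:R)) ^+ 2.
    exact: inner_radius_sq_ge d0 d4 q8.
  have h4 : 1 - d / (8 * (m n)%:R) <= 1 - d / (16 * (m n)%:R) by lra.
  have k0' : (0 <= (k n)%:E)%E by rewrite lee_fin.
  apply: le_trans (lee_wpmul2l k0' (sector_measure_ge h1 h2 h3 h4)).
  rewrite -EFinM lee_fin le_eqVlt; apply/orP; left; apply/eqP.
  by rewrite /k; field; rewrite !gt_eqF.
Qed.

End ratio.

(** * Failure of conformal invariance *)

Lemma almost_decreasing_weaken (R : realType) (K K' : R) (e : R -> R) :
  (forall t, 0 <= t -> t < 1 -> 0 < e t) -> K <= K' ->
  almost_decreasing K e -> almost_decreasing K' e.
Proof.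
move=> epos KK e1 r t r0 rt t1; apply: le_trans (e1 _ _ r0 rt t1) _.
by rewrite ler_wpM2r// ltW// epos// (le_lt_trans rt).
Qed.

Lemma almost_linear_decay_weaken (R : realType) (K K' : R) (e : R -> R) :
  (forall t, 0 <= t -> t < 1 -> 0 < e t) -> K <= K' ->
  almost_linear_decay K e -> almost_linear_decay K' e.
Proof.
move=> epos KK e2 r t r0 rt t1; apply: le_trans (e2 _ _ r0 rt t1) _.
rewrite ler_wpM2r//; first by rewrite ltW// epos// (le_trans r0).
by rewrite ler_wpM2r// subr_ge0 (le_trans rt)// ltW.
Qed.

(** The limit forces psi, hence the tail, to be nonzero near 1. *)
Lemma class_I_integrable (R : realType) (w : R[i] -> R) (f := fun s : R => w s%:C) :
  (forall s, 0 <= s -> s < 1 -> 0 < f s) ->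
  (forall s, 0 <= s -> s < 1 -> {for s, continuous f}) ->
  psi w r / (1 - r) @[r --> 1^'-] --> +oo ->
  (@lebesgue_measure R).-integrable `[0, 1[ (EFin \o f).
Proof.
move=> fpos fcont psiy.
have [r [[r0 r1] psi0]] : exists r, (0 <= r /\ r < 1) /\ 1 <= psi w r / (1 - r).
  have near1 : \forall r \near (1 : R)^'-, (0 <= r /\ r < 1) /\ 1 <= psi w r / (1 - r).
    near=> r; split; [split|].
    - near: r; exact: nbhs_left_ge.
    - near: r; exact: nbhs_left_lt.
    - by near: r; move/cvgryPge : psiy; exact.
  exact: filter_ex near1.
apply: (integrable_of_tail_neq0 fpos fcont r0 r1).
apply: contraTneq psi0 => T0; rewrite -ltNge /psi -/(tail f r) T0.
by rewrite mulr0 mul0r.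
Unshelve. all: by end_near. Qed.

Theorem proposition5p6 (R : realType) (w : R[i] -> R)
  (wI : class_I w)
  (w_incr : essentially_increasing (fun r : R => w r%:C))
  (psi_incr : essentially_increasing (fun r : R => psi w r / (1 - r)))
  (w_doubling : exists2 C : R, 0 < C & forall r : R, 0 <= r -> r < 1 ->
    \int[@lebesgue_measure R]_(s in `[r, 1[) (w s%:C * s) <=
    C * \int[@lebesgue_measure R]_(s in `[2 * r / (1 + r ^+ 2), 1[) (w s%:C * s)) :
  ~ conformally_invariant (C1_space w) (C1_seminorm w).
Proof.
move=> [Cinv Cinv0 inv].
case: wI => -[wpos _] wrad wcont psiy.
case: w_incr => C1 C10 w_incr; case: psi_incr => C2 C20 psi_incr.
case: w_doubling => C C0 w_doubling.
pose f (s : R) := w s%:C.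
have rdisc (s : R) : 0 <= s -> s < 1 -> disc s%:C.
  by move=> s0 s1; rewrite /disc /mkset cmod_real ger0_norm.
have fpos s : 0 <= s -> s < 1 -> 0 < f s by move=> s0 s1; exact/wpos/rdisc.
have fcont s : 0 <= s -> s < 1 -> {for s, continuous f}.
  by move=> s0 s1; apply: continuous_profile; exact/wcont/rdisc.
have fint := class_I_integrable fpos fcont psiy.
have epos := decay_gt0 fpos fcont fint.
pose K := Num.max C1 C2.
have K0 : 0 < K by rewrite lt_max C10.
have e1 : almost_decreasing K (decay f).
  apply: (almost_decreasing_weaken epos (_ : C2 <= K)).
    by rewrite le_max lexx orbT.
  exact: decay_almost_decreasing.
have e2 : almost_linear_decay K (decay f).
  apply: (almost_linear_decay_weaken epos (_ : C1 <= K)).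
    by rewrite le_max lexx.
  exact: decay_almost_linear.
pose p := (Num.bound (320 * 256 * K)).+2.
have p2 : (2 <= p)%N by [].
have pK : 320 * 256 * K <= p%:R.
  apply: (@le_trans _ _ (Num.bound (320 * 256 * K))%:R).
    by apply/ltW/archi_boundP; apply: mulr_ge0 (ltW K0); rewrite -natrM ler0n.
  by rewrite ler_nat /p; lia.
pose B := Cinv * Num.sqrt (20 ^+ 2 * K).
have B0 : 0 <= B by rewrite mulr_ge0 ?sqrtr_ge0// ltW.
pose t := B ^+ 2 + 1.
have t0 : 0 < t by rewrite ltr_wpDl ?sqr_ge0.
have [N HN] :=
  sum_decay_unbounded fpos fcont fint K0 e1 p2 (t * (128 * C) * 256 ^+ 2).
(* As m_n increases with n, this gives 32 m_n d <= 1 for all sectors. *)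
pose d : R := (32 * (gap_exp p N)%:R)^-1.
have mN : 2 <= (gap_exp p N)%:R :> R by rewrite (ler_nat R 2) gap_exp_ge2.
have d0 : 0 < d by rewrite invr_gt0; lra.
have mNd : 32 * (gap_exp p N)%:R * d <= 1 by rewrite mulfV// gt_eqF//; lra.
have d4 : d <= 1 / 4.
  by rewrite mul1r lef_pV2 ?posrE; lra.
have a0 : 0 < 1 - d by lra.
have a1 : 1 - d < 1 by lra.
have dbl := tail_doubling fpos fint C0 a0 a1 (w_doubling _ (ltW a0) a1).
have tS : t <= (\sum_(n < N) (lacunary_coef (decay f) p n / 256) ^+ 2) / (128 * C).
  have q : 0 < 256 ^+ 2 :> R by apply: exprn_gt0; rewrite ltr0n.
  have C128 : 0 < 128 * C by apply: mulr_gt0 C0; rewrite ltr0n.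
  rewrite ler_pdivlMr// -(ler_pM2r q).
  apply: (le_trans HN); rewrite mulr_suml; apply: ler_sum => n _.
  have [n0 n1] := gap_expV_lt1 R n p2.
  have q0 : 0 < decay f (1 - (gap_exp p n)%:R^-1) by apply: epos; [rewrite subr_ge0 ltW|rewrite ltrBlDr ltrDl].
  by rewrite -exprMn divfK ?pnatr_eq0// /lacunary_coef sqr_sqrtr// ltW.
have ratio := lacunary_mobius_ratio_ge wpos wrad fcont fint K0 e1 e2 p2 pK
  C0 d0 d4 dbl mNd t0 tS.
set g := lacunary _ _ _ in ratio.
have gX : C1_space w g by apply: (lacunary_in_C1 (K := K)).
have rg : (C1_seminorm w g <= (Num.sqrt (20 ^+ 2 * K))%:E)%E.
  by apply: lacunary_seminorm_le.
have := inv g gX; apply/negP; rewrite -ltNge.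
apply: (@le_lt_trans _ _ B%:E).
  by rewrite EFinM; apply: lee_wpmul2l => //; rewrite lee_fin ltW.
apply: (@lt_le_trans _ _ (Num.sqrt t)%:E).
  rewrite lte_fin -(ger0_norm B0) -sqrtr_sqr ltr_sqrt//; rewrite /t; lra.
apply: (@le_trans _ _ (C1_seminorm w (g \o mobius (1 - d)))); last first.
  by apply: ereal_sup_ubound; exists (mobius (1 - d)) => //; exact: mobius_is_disc_mobius.
rewrite -[(Num.sqrt t)%:E]/(sqrte t%:E) /C1_seminorm; set S := ereal_sup _.
suff tS' : (t%:E <= S)%E.
  by rewrite lee_sqrt// (le_trans _ tS')// lee_fin ltW.
apply: le_trans ratio _; apply: ereal_sup_ubound.
exists true, false, (- (d / 2)), (d / 2); split => //; first by lra.
have d2 : d / 2 - - (d / 2) <= 2 by lra.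
by apply: (le_trans d2); rewrite ler_peMr// (le_trans _ (pi_ge2 R))// ler1n.
Qed.
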